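(* Let $\Lambda\subset(0,\infty)$ be a nonempty finite or countable set. The group $\mathbb I_\Lambda$ has Kazhdan's property $(T)$ if and only if $\Lambda$ has a maximal element.
   Context: An ultrametric space is a metric space with $d(x,z)\le\max(d(x,y),d(y,z))$; its spectrum is its set of nonzero distances. $\mathbb U_\Lambda$ is the ultrametric Urysohn space: the unique (up to isometry) complete separable ultrametric space with spectrum $\Lambda$ such that for any finite ultrametric spaces $X\subset Y$ with spectra in $\Lambda$, each isometric embedding $X\to\mathbb U_\Lambda$ extends to an isometric embedding $Y\to\mathbb U_\Lambda$. (Model: functions $\omega:\Lambda\to\mathbb Z$ whose support is finite or a sequence converging to $0$, with $d(\omega,\omega')=\max\{\lambda:\omega(\lambda)\ne\omega'(\lambda)\}$ for $\omega\ne\omega'$.) $\mathbb I_\Lambda$ is the group of all bijective isometries of $\mathbb U_\Lambda$ with the topology of pointwise convergence (a Polish group). A topological group $G$ has property $(T)$ if whenever a unitary representation of $G$ weakly contains the trivial representation, it contains the trivial representation as a subrepresentation. *)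

(* Defs.v *)
From HB Require Import structures.
From mathcomp Require Import all_boot all_order all_algebra.
From mathcomp Require Import all_classical all_reals all_analysis.
From mathcomp Require Import complex.

Set Implicit Arguments.
Unset Strict Implicit.
Unset Printing Implicit Defensive.
Import Order.TTheory GRing.Theory Num.Theory.
Import numFieldNormedType.Exports.
Local Open Scope classical_set_scope.
Local Open Scope ring_scope.

HB.mixin Record isTopologicalGroup G of Topological G & Group G := {
  mulg_continuous : continuous (fun p : G * G => (p.1 * p.2)%g);
  invg_continuous : continuous (fun g : G => (g^-1)%g)
}.

#[short(type="topologicalGroupType")]
HB.structure Definition TopologicalGroup :=
  {G of Topological G & Group G & isTopologicalGroup G}.

HB.mixin Record isHilbert (R : realType) V
    of CompleteNormedModule R[i] V := {
  hdot : {dot V for @Num.conj R[i]};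
  hdot_norm : forall v : V, `|v| ^+ 2 = hdot v v
}.

#[short(type="hilbertType")]
HB.structure Definition Hilbert (R : realType) :=
  {V of CompleteNormedModule R[i] V & isHilbert R V}.

Lemma complex_complete (R : realType) (F : set_system R[i]^o) :
  ProperFilter F -> cauchy F -> cvg F.
Proof.
move=> FF /cauchy_ballP Fc.
have cvg_part (p : R[i] -> R) :
    (forall x y, p (x - y) = p x - p y) -> (forall x, `|p x|%:C%C <= `|x|) ->
    exists l : R, p @ F --> l.
  move=> pB ple; apply/cvg_ex; apply: R_complete.
  apply/(@cauchy_ballP R R^o (p @ F)) => e e0.
  have e0C : 0 < e%:C%C by rewrite ltcR.
  have [[A B] /= [FA FB] AB] := Fc _ e0C.
  exists (p @` A, p @` B) => /=.
    by split; [apply: filterS FA|apply: filterS FB] => x ?; exists x.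
  move=> [_ _] /= [[x Ax <-] [y By <-]].
  have := AB (x, y) (conj Ax By); rewrite /ball/= -pB -ltcR.
  exact: le_lt_trans (ple _).
have [a Fa] : exists a : R, (@complex.Re R : R[i] -> R) @ F --> a.
  apply: cvg_part => [|x]; last exact: normc_ge_Re.
  by case=> ? ? [].
have [b Fb] : exists b : R, (@complex.Im R : R[i] -> R) @ F --> b.
  apply: cvg_part => [|x]; first by case=> ? ? [].
  case: x => u v; rewrite normc_def/= lecR -sqrtr_sqr ler_sqrt.
    by rewrite lerDr sqr_ge0.
  by rewrite addr_ge0// sqr_ge0.
apply/cvg_ex; exists (Complex a b); apply/cvgrPdist_lt => e e0.
have [eI eR] : complex.Im e = 0 /\ 0 < complex.Re e.
  by move: e0; rewrite ltcE/= => /andP[/eqP -> ->].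
have eE : e = (complex.Re e)%:C%C by case: e eI {e0 eR} => ? ? /= ->.
have h0 : 0 < complex.Re e / 2 by rewrite divr_gt0.
move/cvgrPdist_lt/(_ _ h0) in Fa.
move/cvgrPdist_lt/(_ _ h0) in Fb.
near=> z.
have za : `|a - complex.Re z| < complex.Re e / 2 by near: z.
have zb : `|b - complex.Im z| < complex.Re e / 2 by near: z.
rewrite eE.
have -> : Complex a b - z =
    (a - complex.Re z)%:C%C + 'i%C * (b - complex.Im z)%:C%C.
  by rewrite [LHS]complexE; case: (z) => ? ?.
apply: le_lt_trans (ler_normD _ _) _.
rewrite normrM !normc_def/= !expr0n/= expr1n !addr0 add0r sqrtr1 !sqrtr_sqr mul1r.
by rewrite -rmorphD/= ltcR [ltRHS]splitr ltrD.
Unshelve. all: by end_near. Qed.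

Definition complex_line (R : realType) : Type := R[i].

Section complex_line.
Variable R : realType.
Notation C := (complex_line R).

HB.instance Definition _ := NormedModule.copy C R[i]^o.
HB.instance Definition _ := Uniform_isComplete.Build C (@complex_complete R).

Definition complex_dot (x y : C) : R[i] := (x : R[i]) * (y : R[i])^*.

Let complex_dot_bilinear :
  bilinear_for ( *%R ) (@Num.conj R[i] \; *%R) complex_dot.
Proof.
split=> [y a u v|x a u v]; rewrite /complex_dot.
  by rewrite mulrDl -mulrA.
by rewrite rmorphD rmorphM mulrDr mulrCA.
Qed.

HB.instance Definition _ :=
  bilinear_isBilinear.Build R[i] C C R[i] ( *%R ) (@Num.conj R[i] \; *%R)
    complex_dot complex_dot_bilinear.

Let complex_dot_hermitian x y :
  complex_dot x y = (-1) ^+ false * (complex_dot y x)^*.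
Proof. by rewrite expr0 mul1r /complex_dot rmorphM/= conjCK mulrC. Qed.

HB.instance Definition _ :=
  isHermitianSesquilinear.Build R[i] C false (@Num.conj R[i]) complex_dot
    complex_dot_hermitian.

Let complex_dot_gt0 (x : C) : x != 0 -> 0 < complex_dot x x.
Proof. by move=> x0; rewrite /complex_dot -normCK exprn_gt0// normr_gt0. Qed.

HB.instance Definition _ := isDotProduct.Build R[i] C complex_dot complex_dot_gt0.

Let complex_dot_norm (x : C) : `|x| ^+ 2 = complex_dot x x.
Proof. exact: normCK. Qed.

HB.instance Definition _ :=
  isHilbert.Build R C complex_dot_norm.

End complex_line.

Section unitary_representations.
Variables (R : realType) (G : topologicalGroupType).

Record unitary_rep := UnitaryRep {
  rep_space : hilbertType R;
  rep_act :> G -> {linear rep_space -> rep_space};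
  rep_act1 : forall v, rep_act 1%g v = v;
  rep_actM : forall g h v, rep_act (g * h)%g v = rep_act g (rep_act h v);
  rep_unitary : forall g u v, hdot (rep_act g u) (rep_act g v) = hdot u v;
  rep_continuous : forall v, continuous (fun g => rep_act g v)
}.

Definition trivial_rep : unitary_rep :=
  @UnitaryRep (complex_line R : hilbertType R) (fun=> idfun)
    (fun=> erefl) (fun _ _ _ => erefl) (fun _ _ _ => erefl)
    (fun v g => cvg_cst v).

(* Fell's definition: every diagonal matrix coefficient of [rho] is, uniformly
   on compact sets, a limit of finite sums of diagonal matrix coefficients
   of [pi]. *)
Definition weakly_contains (pi rho : unitary_rep) : Prop :=
  forall (xi : rep_space rho) (Q : set G) (e : R), compact Q -> 0 < e ->
  exists (n : nat) (eta : 'I_n -> rep_space pi), forall g, Q g ->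
    `|hdot (rho g xi) xi - \sum_(i < n) hdot (pi g (eta i)) (eta i)| < e%:C%C.

(* The range of such a [T] is a closed invariant subspace, on which [pi]
   is unitarily equivalent to [rho]. *)
Definition contains_subrep (pi rho : unitary_rep) : Prop :=
  exists T : {linear rep_space rho -> rep_space pi},
    (forall u v, hdot (T u) (T v) = hdot u v) /\
    (forall g v, T (rho g v) = pi g (T v)).

Definition property_T : Prop :=
  forall pi : unitary_rep,
    weakly_contains pi trivial_rep -> contains_subrep pi trivial_rep.

End unitary_representations.

Section ultrametric_urysohn.
Variable R : realType.

Definition ultrametric (U : metricType R) : Prop :=
  forall x y z : U, mdist x z <= Num.max (mdist x y) (mdist y z).

Definition spectrum (U : metricType R) : set R :=
  [set d | d != 0 /\ exists x y : U, mdist x y = d].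

Definition metric_complete (U : metricType R) : Prop :=
  forall F : set_system U, ProperFilter F -> cauchy F -> exists l : U, F --> l.

Definition separable (U : metricType R) : Prop :=
  exists2 D : set U, countable D & dense D.

Definition isometric_embedding (X Y : metricType R) (f : X -> Y) : Prop :=
  forall x y, mdist (f x) (f y) = mdist x y.

Definition finite_ultrametric (L : set R) (X : metricType R) : Prop :=
  [/\ finite_set [set: X], ultrametric X & spectrum X `<=` L].

(* The inclusion of X in Y is represented by an isometric embedding [i]. *)
Definition finite_extension_property (L : set R) (U : metricType R) : Prop :=
  forall (X Y : metricType R) (i : X -> Y) (f : X -> U),
    finite_ultrametric L X -> finite_ultrametric L Y ->
    isometric_embedding i -> isometric_embedding f ->
    exists2 g : Y -> U, isometric_embedding g & forall x, g (i x) = f x.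

(* For countable L in ]0, +oo[ such a U exists and is unique up to isometry. *)
Definition ultrametric_urysohn (L : set R) (U : metricType R) : Prop :=
  [/\ ultrametric U, metric_complete U, separable U, spectrum U = L
    & finite_extension_property L U].

End ultrametric_urysohn.

Record isometry_group (R : realType) (U : metricType R) := Isometry {
  isometry_fun :> U -> U;
  isometry_isometric : isometric_embedding isometry_fun;
  isometry_bij : bijective isometry_fun
}.

Section isometry_group.
Variables (R : realType) (U : metricType R).
Notation I := (isometry_group U).
Implicit Types f g h : I.

Lemma isometry_eq f g : f =1 g -> f = g.
Proof.
case: f g => [f fi fb] [g gi gb] /= /funext fg; subst g.
by rewrite (Prop_irrelevance fi gi) (Prop_irrelevance fb gb).
Qed.

HB.instance Definition _ := gen_eqMixin I.
HB.instance Definition _ := gen_choiceMixin I.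

Definition isometry_one : I :=
  @Isometry R U idfun (fun _ _ => erefl) (Bijective (frefl _) (frefl _)).

Let comp_isometric f g : isometric_embedding (f \o g).
Proof. by move=> x y /=; rewrite !isometry_isometric. Qed.

Definition isometry_mul f g : I :=
  Isometry (comp_isometric f g)
    (bij_comp (isometry_bij f) (isometry_bij g)).

Lemma isometry_inv_ex f : exists g : I, cancel f g /\ cancel g f.
Proof.
have [g fg gf] := isometry_bij f.
have gi : isometric_embedding g.
  by move=> x y; rewrite -(isometry_isometric f) !gf.
by exists (Isometry gi (Bijective gf fg)).
Qed.

Definition isometry_inv f : I := sval (cid (isometry_inv_ex f)).

Lemma isometry_invK f : cancel f (isometry_inv f).
Proof. by rewrite /isometry_inv; case: cid => g []. Qed.

Lemma isometry_invKV f : cancel (isometry_inv f) f.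
Proof. by rewrite /isometry_inv; case: cid => g []. Qed.

Let mulA : associative isometry_mul.
Proof. by move=> f g h; apply: isometry_eq. Qed.
Let mul1 : left_id isometry_one isometry_mul.
Proof. by move=> f; apply: isometry_eq. Qed.
Let mulr1 : right_id isometry_one isometry_mul.
Proof. by move=> f; apply: isometry_eq. Qed.
Let mulV : left_inverse isometry_one isometry_inv isometry_mul.
Proof. by move=> f; apply: isometry_eq => x /=; rewrite isometry_invK. Qed.
Let mulrV : right_inverse isometry_one isometry_inv isometry_mul.
Proof. by move=> f; apply: isometry_eq => x /=; rewrite isometry_invKV. Qed.

HB.instance Definition _ := isGroup.Build I mulA mul1 mulr1 mulV mulrV.

HB.instance Definition _ :=
  Topological.copy I (initial_topology (@isometry_fun R U : I -> {ptws U -> U})).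

Lemma isometry_cvgP (F : set_system I) (f : I) : Filter F ->
  F --> f <-> forall x, g x @[g --> F] --> f x.
Proof.
move=> FF; split=> [Ff x|Ff].
  have cf : (fun g : I => (g : {ptws U -> U})) @ f --> (f : {ptws U -> U}).
    exact: (@initial_continuous I {ptws U -> U} (@isometry_fun R U)).
  have cx : proj x @ (f : {ptws U -> U}) --> f x := @proj_continuous U (fun=> U) x f.
  have := @cvg_comp _ _ _ _ _ _ _ _ Ff cf.
  by move=> h; exact: (@cvg_comp _ _ _ _ _ _ _ _ h cx).
move=> A [B [[C Cop <-] Cf CA]]; apply: filterS CA _.
have : (fun g : I => (g : {ptws U -> U})) @ F --> (f : {ptws U -> U}).
  by apply/pointwise_cvgP.
by apply; exact: open_nbhs_nbhs.
Qed.

Lemma isometry_mul_continuous :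
  continuous (fun p : I * I => (p.1 * p.2)%g).
Proof.
move=> [f g]; apply/isometry_cvgP => x /=.
have f_cvg : (p.1 : I) (g x) @[p --> (f, g)] --> f (g x).
  have h : (fun p : I * I => p.1) @ (f, g) --> f by exact: cvg_fst.
  exact: (isometry_cvgP _ (fmap_filter _ _)).1 h (g x).
have g_cvg : (p.2 : I) x @[p --> (f, g)] --> g x.
  have h : (fun p : I * I => p.2) @ (f, g) --> g by exact: cvg_snd.
  exact: (isometry_cvgP _ (fmap_filter _ _)).1 h x.
suff fg_cvg : (p.1 : I) ((p.2 : I) x) @[p --> (f, g)] --> f (g x) by [].
apply/metricType_numDomainType.cvgrPdist_lt => e e0.
have e20 : 0 < e / 2 by rewrite divr_gt0.
have {}f_cvg := (metricType_numDomainType.cvgrPdist_lt _ _).1 f_cvg _ e20.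
have {}g_cvg := (metricType_numDomainType.cvgrPdist_lt _ _).1 g_cvg _ e20.
near=> p.
rewrite (le_lt_trans (metric_triangle _ ((p.1 : I) (g x)) _))//.
rewrite [ltRHS]splitr ltrD//; first by near: p; exact: f_cvg.
by rewrite isometry_isometric; near: p; exact: g_cvg.
Unshelve. all: by end_near. Qed.

Lemma isometry_inv_continuous : continuous (fun f : I => (f^-1)%g).
Proof.
move=> f; apply/(isometry_cvgP _ (fmap_filter _ (nbhs_filter f))) => x.
have f_cvg : (g : I) ((f^-1)%g x) @[g --> f] --> f ((f^-1)%g x).
  exact: (isometry_cvgP f (nbhs_filter f)).1 cvg_id _.
rewrite [X in _ --> X]isometry_invKV in f_cvg.
suff inv_cvg : (g^-1 : I)%g x @[g --> f] --> (f^-1)%g x by [].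
have FF := nbhs_filter f.
apply/metricType_numDomainType.cvgrPdist_lt => e e0.
have {}f_cvg := (metricType_numDomainType.cvgrPdist_lt _ _).1 f_cvg _ e0.
near=> g.
rewrite -(isometry_isometric g) [X in mdist _ X]isometry_invKV metric_sym.
by near: g; exact: f_cvg.
Unshelve. all: by end_near. Qed.

HB.instance Definition _ := isTopologicalGroup.Build I
  isometry_mul_continuous isometry_inv_continuous.

End isometry_group.

(* Main.v *)
(* If Lambda has no maximum, the isometry group acts with open stabilizers and
   infinite orbits on the set of balls of radius in Lambda, so l^2 of this set
   has no invariant vector; but a compact set of isometries fixes some ball, so
   the trivial representation is weakly contained in it.

   If m = max Lambda, then U splits into countably many balls {d < m}, indexed by
   nat, and any two of them can be permuted independently. Let H_A be the space
   of vectors fixed by the isometries that are trivial on the balls of a finite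
   set A. These spaces have dense union and the projections satisfy
   P_A P_B = P_{A & B}, whence an orthogonal decomposition into subspaces K_C,
   with C finite, permuted by the group and with K_0 the invariant vectors. If
   K_0 = 0, spreading the mass |v_C|^2 of an almost invariant vector evenly over
   the points of C gives an almost invariant probability on nat, which is
   impossible because nat is paradoxical under three involutions. Hence there is
   a spectral gap for three isometries, uniformly over all representations. *)

Require Import Defs.
From HB Require Import structures.
From mathcomp Require Import all_boot all_order all_algebra finmap.
From mathcomp Require Import all_classical all_reals all_analysis.
From mathcomp Require Import complex ring lra zify.

Set Implicit Arguments.
Unset Strict Implicit.
Unset Printing Implicit Defensive.
Import Order.TTheory GRing.Theory Num.Theory.
Import numFieldNormedType.Exports.
Local Open Scope classical_set_scope.
Local Open Scope ring_scope.

(** * Minimal norm points in Hilbert spaces *)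

(** The pointwise stabilizer of finitely many balls offers no averaging, so P_A v is taken as the
    limit of almost shortest vectors in the midpoint hull of the orbit of v. This form also yields
    P_A P_B = P_{A & B}: nested hulls with the same norms have the same minimal point. Comparing the
    hulls needs much freedom in the group. It comes from the fact that distinct balls {d < m} are at
    distance exactly m, so isometries between single balls glue along any permutation of the balls;
    the isometries themselves come from a back-and-forth construction.

    The empty C is the one index whose mass cannot be spread, and its component is exactly the
    invariant one. Involutions are convenient in the paradox because they preserve a finite set of
    balls after one enlargement, so that all sums stay finite.

    Weak containment only provides finite sums of coefficients, not one almost invariant vector. The
    gap is therefore stated for squared norms, which add up over the summands. *)

Section real_inner_product.
Variables (R : realType) (V : hilbertType R).
Implicit Types (u v w x y : V).

Lemma ReD (a b : R[i]) : complex.Re (a + b) = complex.Re a + complex.Re b.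
Proof. by case: a => ? ?; case: b. Qed.

Lemma ReN (a : R[i]) : complex.Re (- a) = - complex.Re a.
Proof. by case: a. Qed.

Lemma Re_sum (I : Type) (r : seq I) (P : pred I) (F : I -> R[i]) :
  complex.Re (\sum_(i <- r | P i) F i) = \sum_(i <- r | P i) complex.Re (F i).
Proof. by elim/big_rec2: _ => // i ? ? _ <-; rewrite ReD. Qed.

Lemma pos_complexE (e : R[i]) : 0 < e -> exists2 r : R, 0 < r & e = r%:C%C.
Proof.
case: e => a b; rewrite ltcE /= => /andP[/eqP -> a0].
by exists a.
Qed.

(** Real orthogonality is enough for the parallelogram identity, for Pythagoras and for minimal
    norms, and it keeps all estimates in the ordered field [R]. *)
Definition rdot u v : R := complex.Re (hdot u v).

Lemma rdotDl u v w : rdot (u + v) w = rdot u w + rdot v w.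
Proof. by rewrite /rdot linearDl ReD. Qed.

Lemma rdotDr u v w : rdot w (u + v) = rdot w u + rdot w v.
Proof. by rewrite /rdot linearDr ReD. Qed.

Lemma rdotNl u v : rdot (- u) v = - rdot u v.
Proof. by rewrite /rdot linearNl ReN. Qed.

Lemma rdotNr u v : rdot u (- v) = - rdot u v.
Proof. by rewrite /rdot linearNr ReN. Qed.

Lemma rdotBl u v w : rdot (u - v) w = rdot u w - rdot v w.
Proof. by rewrite rdotDl rdotNl. Qed.

Lemma rdotBr u v w : rdot w (u - v) = rdot w u - rdot w v.
Proof. by rewrite rdotDr rdotNr. Qed.

Lemma rdot0l u : rdot 0 u = 0.
Proof. by rewrite -(subrr 0) rdotBl subrr. Qed.

Lemma rdot0r u : rdot u 0 = 0.
Proof. by rewrite -(subrr 0) rdotBr subrr. Qed.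

Lemma rdotC u v : rdot u v = rdot v u.
Proof.
rewrite /rdot [in LHS](hermC hdot) expr0 mul1r.
by set z := hdot v u; change (complex.Re (conjc z) = complex.Re z); case: z.
Qed.

Lemma rdot_suml (I : Type) (r : seq I) (F : I -> V) w :
  rdot (\sum_(i <- r) F i) w = \sum_(i <- r) rdot (F i) w.
Proof. by elim/big_rec2: _ => [|i ? ? _ <-]; rewrite ?rdot0l ?rdotDl. Qed.

Lemma rdot_sumr (I : Type) (r : seq I) (F : I -> V) w :
  rdot w (\sum_(i <- r) F i) = \sum_(i <- r) rdot w (F i).
Proof. by elim/big_rec2: _ => [|i ? ? _ <-]; rewrite ?rdot0r ?rdotDr. Qed.

Lemma norm_complexE v : exists2 r : R, 0 <= r & `|v| = r%:C%C.
Proof.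
have := normr_ge0 v; case: (`|v|) => a b.
by rewrite lecE/= => /andP[/eqP -> a0]; exists a.
Qed.

Definition rnorm v : R := complex.Re `|v|.

Lemma rnormE v : `|v| = (rnorm v)%:C%C.
Proof. by rewrite /rnorm; have [r _ ->] := norm_complexE v. Qed.

Lemma rnorm_ge0 v : 0 <= rnorm v.
Proof. by rewrite -lecR -rnormE normr_ge0. Qed.

Lemma rdotvv v : rdot v v = rnorm v ^+ 2.
Proof. by rewrite /rdot -hdot_norm rnormE -rmorphXn. Qed.

Lemma rdot_ge0 v : 0 <= rdot v v.
Proof. by rewrite rdotvv sqr_ge0. Qed.

Lemma rdot_eq0 v : rdot v v = 0 -> v = 0.
Proof.
rewrite rdotvv => /eqP; rewrite sqrf_eq0 => /eqP v0.
by apply/eqP; rewrite -normr_eq0 rnormE v0.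
Qed.

Lemma rnormD u v : rnorm (u + v) <= rnorm u + rnorm v.
Proof. by rewrite -lecR rmorphD/= -!rnormE ler_normD. Qed.

Lemma rnormN v : rnorm (- v) = rnorm v.
Proof. by rewrite /rnorm normrN. Qed.

Lemma rnormBC u v : rnorm (u - v) = rnorm (v - u).
Proof. by rewrite -rnormN opprB. Qed.

Lemma rnorm_triangle v u w : rnorm (u - w) <= rnorm (u - v) + rnorm (v - w).
Proof. by rewrite -(subrKA v) rnormD. Qed.

Lemma rdot_le u v : rdot u v <= rnorm u * rnorm v.
Proof.
have uv : rnorm (u + v) ^+ 2 <= (rnorm u + rnorm v) ^+ 2.
  by rewrite ler_pXn2r ?nnegrE ?addr_ge0 ?rnorm_ge0// rnormD.
move: uv; rewrite -rdotvv rdotDl !rdotDr !rdotvv (rdotC v u).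
by move=> uv; nra.
Qed.

Lemma rdot_half u v : rdot (2^-1 *: u) v = rdot u v / 2.
Proof.
have : rdot (2^-1 *: u + 2^-1 *: u) v = rdot u v.
  by rewrite -scalerDl -div1r -splitr scale1r.
by rewrite rdotDl => /esym ->; field.
Qed.

Lemma parallelogram u v :
  rdot (u - v) (u - v) =
  2 * rdot u u + 2 * rdot v v - 4 * rdot (2^-1 *: (u + v)) (2^-1 *: (u + v)).
Proof.
rewrite rdot_half [rdot (u + v) _]rdotC rdot_half.
rewrite !rdotBl !rdotBr !rdotDl !rdotDr (rdotC v u); by field.
Qed.

Lemma rnorm_lt_eq0 v : (forall e, 0 < e -> rnorm v < e) -> v = 0.
Proof.
move=> ve; apply: rdot_eq0; rewrite rdotvv.
have -> : rnorm v = 0; last by rewrite expr0n.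
apply/eqP; rewrite eq_le rnorm_ge0 andbT leNgt; apply/negP => /ve.
by rewrite ltxx.
Qed.

Lemma rdot_self_lt v e : 0 < e -> rdot v v < e ^+ 2 -> rnorm v < e.
Proof.
by move=> e0; rewrite rdotvv ltr_pXn2r ?nnegrE ?rnorm_ge0 ?ltW.
Qed.

Section near_minimizers.
Variable S : V -> Prop.
Hypothesis S_neq0 : exists x, S x.
Hypothesis S_mid : forall x y, S x -> S y -> S (2^-1 *: (x + y)).

Definition min_norm2 : R := inf [set rdot x x | x in S].

Lemma min_norm2_le x : S x -> min_norm2 <= rdot x x.
Proof.
move=> Sx; apply: ge_inf; last by exists x.
by exists 0 => _ [y _ <-]; exact: rdot_ge0.
Qed.

Lemma near_minimizer_ex e : 0 < e ->
  exists2 x, S x & rdot x x < min_norm2 + e.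
Proof.
move=> e0.
have : has_inf [set rdot x x | x in S].
  split; first by have [x Sx] := S_neq0; exists (rdot x x), x.
  by exists 0 => _ [y _ <-]; exact: rdot_ge0.
by move=> /(inf_adherent e0)[_ [x Sx <-] xe]; exists x.
Qed.

Lemma near_minimizers_close x y e : S x -> S y ->
  rdot x x < min_norm2 + e -> rdot y y < min_norm2 + e ->
  rdot (x - y) (x - y) < 4 * e.
Proof.
move=> Sx Sy xe ye; rewrite parallelogram.
have := min_norm2_le (S_mid Sx Sy); lra.
Qed.

(** By the parallelogram identity the sets of near-minimizers generate a Cauchy filter. [S] is only
    closed under midpoints, so the limit need not belong to it: it is described by its distance to
    the near-minimizers. *)
Lemma min_norm_ex : exists u, forall e, 0 < e -> exists2 d, 0 < d &
  forall x, S x -> rdot x x < min_norm2 + d -> rnorm (u - x) < e.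
Proof.
pose B (d : R) := [set x | S x /\ rdot x x < min_norm2 + d].
pose F := filter_from [set d : R | 0 < d] B.
have FF : ProperFilter F.
  apply: filter_from_proper; last first.
    by move=> d /= /near_minimizer_ex[x ? ?]; exists x.
  apply: filter_from_filter; first by exists 1 => /=.
  move=> d d' /= d0 d'0; exists (Num.min d d'); first by rewrite lt_min d0.
  move=> x [Sx xd]; split; split=> //; apply: lt_le_trans xd _;
    by rewrite lerD2l ge_min lexx ?orbT.
have Fc : cauchy F.
  apply/cauchy_ballP => _ /pos_complexE[e e0 ->].
  (* This cancels the factor 4 of [near_minimizers_close]. *)
  pose d := e ^+ 2 / 4; have d0 : 0 < d by rewrite divr_gt0// exprn_gt0.
  exists (B d, B d); first by split; exists d.
  move=> [x y] /= [[Sx xd] [Sy yd]]; rewrite -ball_normE/= rnormE ltcR.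
  apply: rdot_self_lt => //.
  by have := near_minimizers_close Sx Sy xd yd; rewrite /d; lra.
have /cvg_ex[u Fu] := @cauchy_cvg _ F FF Fc.
exists u => e e0.
have e0C : 0 < (e / 2)%:C%C by rewrite ltcR divr_gt0.
have [d d0 dB] : F (ball u (e / 2)%:C%C) by apply: Fu; exact: nbhsx_ballx.
have e4 : 0 < (e / 2) ^+ 2 / 4 by rewrite divr_gt0// exprn_gt0// divr_gt0.
exists (Num.min d ((e / 2) ^+ 2 / 4)); first by rewrite lt_min d0.
move=> x Sx xd; have := dB x; rewrite -ball_normE/= rnormE ltcR => xe.
apply: (lt_trans (xe _)); last by lra.
by split=> //; apply: lt_le_trans xd _; rewrite lerD2l ge_min lexx.
Qed.

Definition min_norm_pt : V := sval (cid min_norm_ex).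

Lemma min_norm_ptP e : 0 < e -> exists2 d, 0 < d &
  forall x, S x -> rdot x x < min_norm2 + d -> rnorm (min_norm_pt - x) < e.
Proof. by rewrite /min_norm_pt; case: cid => u /= uP; exact: uP. Qed.

Lemma min_norm_pt_adherent e : 0 < e ->
  exists2 x, S x & rnorm (min_norm_pt - x) < e.
Proof.
by move=> /min_norm_ptP[d /near_minimizer_ex[x Sx xd] dP]; exists x; auto.
Qed.

(** [T] sends near-minimizers to near-minimizers, so for such an [x] the vector [T x] is close both
    to [min_norm_pt] and to its image. *)
Lemma min_norm_pt_fixed (T : {linear V -> V}) :
  (forall x, rdot (T x) (T x) = rdot x x) -> (forall x, S x -> S (T x)) ->
  T min_norm_pt = min_norm_pt.
Proof.
move=> Tiso TS; apply/eqP; rewrite -subr_eq0; apply/eqP.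
apply: rnorm_lt_eq0 => e e0; have e20 : 0 < e / 2 by rewrite divr_gt0.
have [d d0 dP] := min_norm_ptP e20.
have [x Sx xd] := near_minimizer_ex d0.
apply: le_lt_trans (rnorm_triangle (T x) _ _) _; rewrite [ltRHS]splitr ltrD//.
  rewrite -linearB/=; apply: rdot_self_lt => //.
  by rewrite Tiso rdotvv ltr_pXn2r ?nnegrE ?rnorm_ge0 ?ltW//; exact: dP.
by rewrite rnormBC; apply: dP; [exact: TS|rewrite Tiso].
Qed.

End near_minimizers.

(** The hypotheses force equal infima, so a near-minimizer of the smaller set [S'] is close to both
    minimal points. *)
Lemma min_norm_pt_eq (S S' : V -> Prop)
  (S0 : exists x, S x) (Sm : forall x y, S x -> S y -> S (2^-1 *: (x + y)))
  (S'0 : exists x, S' x) (S'm : forall x y, S' x -> S' y -> S' (2^-1 *: (x + y))) :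
  (forall x, S' x -> S x) ->
  (forall x, S x -> exists2 y, S' y & rdot y y = rdot x x) ->
  min_norm_pt S0 Sm = min_norm_pt S'0 S'm.
Proof.
move=> S'S SS'.
have mE : min_norm2 S' = min_norm2 S.
  rewrite /min_norm2; congr inf; apply/seteqP; split=> _ [x Sx <-].
    by exists x => //; exact: S'S.
  by have [y S'y <-] := SS' _ Sx; exists y.
apply/eqP; rewrite -subr_eq0; apply/eqP.
apply: rnorm_lt_eq0 => e e0; have e20 : 0 < e / 2 by rewrite divr_gt0.
have [d d0 dP] := min_norm_ptP S0 Sm e20.
have [d' d'0 d'P] := min_norm_ptP S'0 S'm e20.
have m0 : 0 < Num.min d d' by rewrite lt_min d0.
have [x S'x xm] := near_minimizer_ex S'0 m0.
apply: le_lt_trans (rnorm_triangle x _ _) _; rewrite [ltRHS]splitr ltrD//.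
  apply: dP; [exact: S'S|rewrite -mE; apply: lt_le_trans xm _].
  by rewrite lerD2l ge_min lexx.
rewrite rnormBC; apply: d'P => //; apply: lt_le_trans xm _.
by rewrite lerD2l ge_min lexx orbT.
Qed.

End real_inner_product.

(** * Isometries of the ultrametric Urysohn space *)

Section finite_metric_space.
Variables (R : realType) (T : choiceType) (d : T -> T -> R).
Hypotheses (dxx : forall x, d x x = 0) (d_eq0 : forall x y, d x y = 0 -> x = y)
  (d_sym : forall x y, d x y = d y x)
  (d_ultra : forall x y z, d x z <= Num.max (d x y) (d y z)).

Lemma ultra_ge0 x y : 0 <= d x y.
Proof. by have := d_ultra x y x; rewrite dxx d_sym maxxx. Qed.

Lemma ultra_triangle y x z : d x z <= d x y + d y z.
Proof.
by rewrite (le_trans (d_ultra _ y _))// ge_max lerDl lerDr !ultra_ge0.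
Qed.

(** The alias carries the metric axioms as arguments, so that the metric instance declared on it can
    be found from the type alone. *)
Definition ultra_space of (forall x, d x x = 0) & (forall x y, d x y = 0 -> x = y)
  & (forall x y, d x y = d y x)
  & (forall x y z, d x z <= Num.max (d x y) (d y z)) : Type := T.

Local Notation M := (ultra_space dxx d_eq0 d_sym d_ultra).

HB.instance Definition _ := Choice.on M.
HB.instance Definition _ :=
  isMetric.Build R M dxx d_eq0 d_sym ultra_triangle.

Definition ultra_metricType : metricType R := M.

Lemma finite_ultra_space (L : set R) : finite_set [set: T] ->
  (forall x y, x <> y -> L (d x y)) -> finite_ultrametric L ultra_metricType.
Proof.
move=> Tfin Ld; split=> // e [/eqP e0 [x [y xye]]]; rewrite -xye.
by apply: Ld => xy; apply: e0; rewrite -xye xy; exact: dxx.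
Qed.

End finite_metric_space.

Section urysohn.
Variables (R : realType) (L : set R) (U : metricType R).
Hypotheses (L_pos : L `<=` [set x | 0 < x]) (UU : ultrametric_urysohn L U).

Lemma urysohn_ultra (x y z : U) : mdist x z <= Num.max (mdist x y) (mdist y z).
Proof. by have [+ _ _ _ _] := UU; apply. Qed.

Lemma urysohn_dist (x y : U) : x <> y -> L (mdist x y).
Proof.
move=> xy; have [_ _ _ <- _] := UU; split; last by exists x, y.
by apply/eqP => /mdist_positivity.
Qed.

(** One-point extension: the conditions on [phi] say that adding a point ([None] below) at distances
    [phi] keeps the finite space ultrametric with spectrum in [L]. *)
Lemma urysohn_point (s : seq U) (phi : U -> R) :
  {in s, forall x, L (phi x)} ->
  {in s &, forall x y, phi x <= Num.max (phi y) (mdist x y)} ->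
  {in s &, forall x y, mdist x y <= Num.max (phi x) (phi y)} ->
  exists z, {in s, forall x, mdist z x = phi x}.
Proof.
move=> Lphi phiL phiU.
have phi_gt0 x : x \in s -> 0 < phi x by move=> /Lphi /L_pos.
pose X := seq_sub s.
pose dX (x y : X) : R := mdist (val x) (val y).
pose dY (x y : option X) : R := match x, y with
  | None, None => 0 | Some x, None => phi (val x) | None, Some y => phi (val y)
  | Some x, Some y => mdist (val x) (val y) end.
have dXxx x : dX x x = 0 by exact: mdistxx.
have dX0 x y : dX x y = 0 -> x = y by move=> /mdist_positivity/val_inj.
have dXs x y : dX x y = dX y x by exact: metric_sym.
have dXu x y z : dX x z <= Num.max (dX x y) (dX y z) by exact: urysohn_ultra.
have dYxx x : dY x x = 0 by case: x => [x|]//=; exact: mdistxx.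
have dY0 x y : dY x y = 0 -> x = y.
  case: x => [x|]; case: y => [y|]//=.
  - by move=> /mdist_positivity/val_inj ->.
  - by have := phi_gt0 _ (valP x) => /[swap] ->; rewrite ltxx.
  - by have := phi_gt0 _ (valP y) => /[swap] ->; rewrite ltxx.
have dYs x y : dY x y = dY y x.
  by case: x => [x|]; case: y => [y|]//=; exact: metric_sym.
have dYu x y z : dY x z <= Num.max (dY x y) (dY y z).
  case: x => [x|]; case: y => [y|]; case: z => [z|] //=.
  - exact: urysohn_ultra.
  - by rewrite maxC; apply: phiL; exact: valP.
  - by apply: phiU; exact: valP.
  - by rewrite le_max lexx.
  - by rewrite metric_sym; apply: phiL; exact: valP.
  - by rewrite le_max (ltW (phi_gt0 _ (valP y))).
  - by rewrite le_max lexx orbT.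
pose MX := ultra_metricType dXxx dX0 dXs dXu.
pose MY := ultra_metricType dYxx dY0 dYs dYu.
have [_ _ _ _ ext] := UU.
have [||||g gi gf] := ext MX MY (Some : MX -> MY) (val : X -> U).
- apply: finite_ultra_space; first exact: finite_finset.
  by move=> x y xy; apply: urysohn_dist => /val_inj.
- apply: finite_ultra_space; first exact: finite_finset.
  move=> [x|] [y|]//= xy; [|exact: Lphi (valP x)|exact: Lphi (valP y)].
  by apply: urysohn_dist => /val_inj xy'; apply: xy; rewrite xy'.
- by move=> x y.
- by move=> x y.
exists (g None) => x xs.
have /= gx := gf (SeqSub xs).
by rewrite -[X in mdist _ X]gx gi.
Qed.

Lemma urysohn_away (l : R) (s : seq U) : L l ->
  {in s &, forall x y, mdist x y <= l} ->
  exists z, {in s, forall x, mdist z x = l}.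
Proof.
move=> Ll sl; apply: (@urysohn_point s (fun=> l)) => // x y xs ys.
  by rewrite le_max lexx.
by rewrite maxxx; exact: sl.
Qed.

Lemma urysohn_spread (l : R) x0 : L l ->
  exists z : nat -> U, z 0%N = x0 /\ forall i j, i != j -> mdist (z i) (z j) = l.
Proof.
move=> Ll.
have l0 : 0 < l := L_pos Ll.
pose ok (s : seq U) := {in s &, forall x y, mdist x y <= l}.
have step (s : {s : seq U | ok s}) :
    {z : U | {in sval s, forall x, mdist z x = l}}.
  by case: s => s sok; apply: cid; exact: urysohn_away.
have ok1 : ok [:: x0].
  by move=> x y; rewrite !inE => /eqP -> /eqP ->; rewrite mdistxx ltW.
have okS (s : {s : seq U | ok s}) : ok (sval (step s) :: sval s).
  case: (step s) => z /= zs x y; rewrite !inE.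
  move=> /predU1P[->|xs] /predU1P[->|ys].
  - by rewrite mdistxx ltW.
  - by rewrite zs.
  - by rewrite metric_sym zs.
  - by case: s xs ys {zs} => s sok /=; exact: sok.
(* [S n] lists the points chosen so far, newest first, so its head is the n-th one. *)
pose S n := iter n (fun s => exist ok _ (okS s)) (exist ok _ ok1).
pose z n := head x0 (sval (S n)).
have zin i j : (i <= j)%N -> z i \in sval (S j).
  elim: j => [|j IH]; first by rewrite leqn0 => /eqP ->; rewrite inE.
  rewrite leq_eqVlt => /predU1P[->|ij]; first by rewrite inE eqxx.
  by rewrite inE IH ?orbT.
exists z; split=> //.
have lt_case i j : (i < j)%N -> mdist (z j) (z i) = l.
  case: j => // j ij; rewrite /z /=; case: (step (S j)) => w /= -> //.
  exact: zin.
by move=> i j; rewrite neq_ltn => /orP[]/lt_case // <-; exact: metric_sym.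
Qed.

End urysohn.

Section extend_isometry.
Variables (R : realType) (U : metricType R) (Gam : U -> U -> Prop).
Hypotheses (U_complete : metric_complete U)
  (Gam_iso : forall a b a' b', Gam a b -> Gam a' b' -> mdist a a' = mdist b b')
  (Gam_dense : forall u e, 0 < e -> exists a b, Gam a b /\ mdist u a < e).

Lemma mdist_approx (x y a b : U) :
  `|mdist x y - mdist a b| <= mdist x a + mdist y b.
Proof.
have xa := metric_triangle x a y; have ay := metric_triangle a b y.
have ax := metric_triangle a x b; have xb := metric_triangle x y b.
rewrite (metric_sym b y) in ay; rewrite (metric_sym a x) in ax.
by rewrite ler_norml; apply/andP; split; lra.
Qed.

(** An isometric relation with dense domain extends by completeness. The value at [u] is specified
    by its distances to the range, a form that applies equally to the converse relation. *)
Lemma relation_extension :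
  exists f : U -> U, forall u a b, Gam a b -> mdist (f u) b = mdist u a.
Proof.
suff ex_w u : exists w, forall a b, Gam a b -> mdist w b = mdist u a.
  by have [f fP] := choice ex_w; exists f.
(* These are the partners of the points close to [u]; they generate a Cauchy filter whose limit is
   the wanted value. *)
pose B (e : R) := [set b | exists2 a, Gam a b & mdist u a < e].
pose F := filter_from [set e : R | 0 < e] B.
have FF : ProperFilter F.
  apply: filter_from_proper; last first.
    by move=> e /= /(Gam_dense u)[a [b [ab ua]]]; exists b, a.
  apply: filter_from_filter; first by exists 1 => /=.
  move=> d d' /= d0 d'0; exists (Num.min d d'); first by rewrite lt_min d0.
  by move=> b [a ab]; rewrite lt_min => /andP[ud ud']; split; exists a.
have Fc : cauchy F.
  apply/cauchy_ballP => e e0; have e20 : 0 < e / 2 by rewrite divr_gt0.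
  exists (B (e / 2), B (e / 2)); first by split; exists (e / 2).
  move=> [b b'] /= [[a ab ua] [a' ab' ua']]; rewrite ballEmdist/=.
  rewrite -(Gam_iso ab ab') (le_lt_trans (metric_triangle _ u _))//.
  by rewrite [ltRHS]splitr metric_sym ltrD.
have [w Fw] := U_complete FF Fc.
exists w => a b ab; apply/eqP; rewrite -subr_eq0 -normr_le0.
apply/ler_addgt0Pl => e e0; rewrite addr0.
have e20 : 0 < e / 2 by rewrite divr_gt0.
have [d d0 dB] : F (ball w (e / 2)) by apply: Fw; exact: nbhsx_ballx.
have m0 : 0 < Num.min d (e / 2) by rewrite lt_min d0.
have [a' [b' [ab']]] := Gam_dense u m0; rewrite lt_min => /andP[ud ue].
have wb' : mdist w b' < e / 2.
  by have := dB b'; rewrite ballEmdist; apply; exists a'.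
have := mdist_approx w b b' b; have := mdist_approx u a a' a.
rewrite !mdistxx !addr0 (Gam_iso ab' ab) => h1 h2.
move: h1 h2; rewrite !ler_norml => /andP[? ?] /andP[? ?].
by apply/andP; split; lra.
Qed.

End extend_isometry.

Section homogeneity.
Variables (R : realType) (L : set R) (U : metricType R).
Hypotheses (L_pos : L `<=` [set x | 0 < x]) (UU : ultrametric_urysohn L U).

Definition partial_iso (p : seq (U * U)) :=
  {in p &, forall q r, mdist q.1 r.1 = mdist q.2 r.2}.

Lemma partial_iso_dom p a : partial_iso p -> exists b, partial_iso ((a, b) :: p).
Proof.
move=> piso.
suff [b bP] : exists b, {in p, forall q, mdist a q.1 = mdist b q.2}.
  exists b => q r; rewrite !inE => /predU1P[->|qp] /predU1P[->|rp] /=.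
  - by rewrite !mdistxx.
  - exact: bP.
  - by rewrite metric_sym bP// metric_sym.
  - exact: piso.
have [/mapP[q qp ->]|ap] := boolP (a \in [seq q.1 | q <- p]).
  by exists q.2 => r rp; exact: piso.
(* The new image must be as far from [y] as [a] is from the partner of [y]. The partner is unique
   since a partial isometry is injective, and the default 0 never occurs on the range of [p]. *)
pose phi y := if pselect (exists2 q, q \in p & q.2 = y) is left h
  then mdist a (sval (cid2 h)).1 else 0.
have phiE q : q \in p -> phi q.2 = mdist a q.1.
  move=> qp; rewrite /phi; case: pselect => [h|]; last by case; exists q.
  case: (cid2 h) => q' /= q'p q'q; congr (mdist a _).
  by apply: mdist_positivity; rewrite piso// q'q mdistxx.
have [x /mapP[q qp ->]|x y /mapP[q qp ->] /mapP[r rp ->]|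
      x y /mapP[q qp ->] /mapP[r rp ->]|z zP] :=
    urysohn_point L_pos UU (s := [seq q.2 | q <- p]) (phi := phi).
- rewrite phiE//; apply: (urysohn_dist UU) => aq.
  by move: ap; rewrite aq map_f.
- rewrite !phiE// -piso// (metric_sym q.1); exact: (urysohn_ultra UU).
- rewrite !phiE// -piso// (metric_sym a); exact: (urysohn_ultra UU).
by exists z => q qp; rewrite zP ?map_f// phiE.
Qed.

Lemma partial_iso_swap p : partial_iso p -> partial_iso [seq (q.2, q.1) | q <- p].
Proof. by move=> piso _ _ /mapP[q qp ->] /mapP[r rp ->] /=; rewrite piso. Qed.

Lemma partial_iso_ran p b : partial_iso p -> exists a, partial_iso ((a, b) :: p).
Proof.
move=> /partial_iso_swap/(partial_iso_dom b)[a /partial_iso_swap].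
rewrite /= -map_comp (eq_map (g := id)) ?map_id; last by case.
by exists a.
Qed.

Lemma dense_sequence (x : U) :
  exists e : nat -> U, forall u d, 0 < d -> exists n, mdist u (e n) < d.
Proof.
have [_ _ [D /countable_injP[f finj] Dd] _ _] := UU.
(* The injection [f] of the dense set into nat is inverted; indices outside its image get the
   default [x]. *)
exists (fun n => xget x [set y | D y /\ f y = n]) => u d d0.
have [y [/interior_subset uy Dy]] : (ball u d)^° `&` D !=set0.
  apply: Dd; last exact: open_interior.
  by exists u; exact: nbhsx_ballx.
exists (f y); case: xgetP => [z _ [Dz fz]|/(_ y)[]//].
rewrite (finj z y) ?inE//; move: uy; by rewrite ballEmdist.
Qed.

(** Back-and-forth from the single pair [(x, y)]: stage n puts the n-th point of a dense sequence
    both into the domain and into the range. The union and its converse then extend to mutually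
    inverse maps. *)
Lemma isometry_transitive (x y : U) : exists g : isometry_group U, g x = y.
Proof.
have [e eP] := dense_sequence x.
have step (s : nat * {p | partial_iso p}) : {p | [/\ partial_iso p,
    {subset sval s.2 <= p}, (exists b, (e s.1, b) \in p)
    & (exists a, (a, e s.1) \in p)]}.
  case: s => n [p pi]; apply: cid => /=.
  have [b bpi] := partial_iso_dom (e n) pi.
  have [a abpi] := partial_iso_ran (e n) bpi.
  exists ((a, e n) :: (e n, b) :: p); split=> //.
  - by move=> q qp; rewrite !inE qp !orbT.
  - by exists b; rewrite !inE eqxx orbT.
  - by exists a; rewrite !inE eqxx.
have pi0 : partial_iso [:: (x, y)].
  by move=> q r; rewrite !inE => /eqP -> /eqP ->; rewrite !mdistxx.
have stepi s : partial_iso (sval (step s)) by case: (step s) => p /= [].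
pose S := fix S n := if n is m.+1
  then exist _ _ (stepi (m, S m)) else exist partial_iso _ pi0.
have Ssub m n : (m <= n)%N -> {subset sval (S m) <= sval (S n)}.
  elim: n => [|n IH]; first by rewrite leqn0 => /eqP ->.
  rewrite leq_eqVlt => /predU1P[-> //|/IH mn] q /mn qn /=.
  by case: (step _) => p /= [_ + _ _]; exact.
pose Gam a b := exists n, (a, b) \in sval (S n).
have Giso a b a' b' : Gam a b -> Gam a' b' -> mdist a a' = mdist b b'.
  move=> [n nab] [n' nab'].
  exact: (svalP (S (maxn n n')) (a, b) (a', b') (Ssub _ _ (leq_maxl _ _) _ nab)
    (Ssub _ _ (leq_maxr _ _) _ nab')).
have Gdom u d : 0 < d -> exists a b, Gam a b /\ mdist u a < d.
  move=> /(eP u)[n un]; have [b nb] : exists b, (e n, b) \in sval (S n.+1).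
    by rewrite /=; case: (step _) => p /= [].
  by exists (e n), b; split=> //; exists n.+1.
have Gran u d : 0 < d -> exists b a, Gam a b /\ mdist u b < d.
  move=> /(eP u)[n un]; have [a na] : exists a, (a, e n) \in sval (S n.+1).
    by rewrite /=; case: (step _) => p /= [].
  by exists (e n), a; split=> //; exists n.+1.
have [_ Uc _ _ _] := UU.
have [f fP] := relation_extension Uc Giso Gdom.
have [f' f'P] := relation_extension (Gam := fun b a => Gam a b) Uc
  (fun b a b' a' h h' => esym (Giso a b a' b' h h')) Gran.
(* A point is determined by its distances to a dense set; this is how the two extensions are shown
   to be inverse to each other. *)
have det_ran u v : (forall a b, Gam a b -> mdist u b = mdist v b) -> u = v.
  move=> uv; apply: mdist_positivity; apply/eqP; rewrite -normr_le0.
  apply/ler_addgt0Pl => d d0; rewrite addr0.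
  have d20 : 0 < d / 2 by rewrite divr_gt0.
  have [b [a [ab ub]]] := Gran u _ d20.
  rewrite ger0_norm ?mdist_ge0// (le_trans (metric_triangle _ b _))//.
  by rewrite (metric_sym b) -(uv a b)// [leRHS]splitr lerD// ltW.
have det_dom u v : (forall a b, Gam a b -> mdist u a = mdist v a) -> u = v.
  move=> uv; apply: mdist_positivity; apply/eqP; rewrite -normr_le0.
  apply/ler_addgt0Pl => d d0; rewrite addr0.
  have d20 : 0 < d / 2 by rewrite divr_gt0.
  have [a [b [ab ub]]] := Gdom u _ d20.
  rewrite ger0_norm ?mdist_ge0// (le_trans (metric_triangle _ a _))//.
  by rewrite (metric_sym a) -(uv a b)// [leRHS]splitr lerD// ltW.
have fiso : isometric_embedding f.
  move=> u v; apply/eqP; rewrite -subr_eq0 -normr_le0.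
  apply/ler_addgt0Pl => d d0; rewrite addr0.
  have d20 : 0 < d / 2 by rewrite divr_gt0.
  have [a [b [ab va]]] := Gdom v _ d20.
  have := mdist_approx (f u) (f v) (f u) b; have := mdist_approx u v u a.
  rewrite !mdistxx !add0r !(fP _ _ _ ab) => h1 h2.
  move: h1 h2; rewrite !ler_norml => /andP[? ?] /andP[? ?].
  by apply/andP; split; lra.
have fb : bijective f.
  exists f' => u; [apply: det_dom|apply: det_ran] => a b ab.
    by rewrite (f'P _ _ _ ab) (fP _ _ _ ab).
  by rewrite (fP _ _ _ ab) (f'P _ _ _ ab).
exists (Isometry fiso fb) => /=.
apply: mdist_positivity; rewrite (fP _ x) ?mdistxx//.
by exists 0%N; rewrite inE.
Qed.

End homogeneity.

(** * Gluing isometries of maximal balls *)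

Section ball_classes.
Variables (R : realType) (L : set R) (U : metricType R).
Hypotheses (L_pos : L `<=` [set x | 0 < x]) (UU : ultrametric_urysohn L U).
Variable m : R.
Hypotheses (Lm : L m) (m_max : forall x, L x -> x <= m).

Lemma urysohn_le_max (x y : U) : mdist x y <= m.
Proof.
have [->|/eqP xy] := eqVneq x y; first by rewrite mdistxx ltW// L_pos.
by apply/m_max/(urysohn_dist UU).
Qed.

(** The balls {d < m} are countably many by separability and infinitely many because there is a
    sequence of points at mutual distance [m]; hence nat can label them bijectively. *)
Lemma class_map_ex : exists c : U -> nat,
  (forall x y, c x = c y <-> mdist x y < m) /\ forall n, exists x, c x = n.
Proof.
have [x0] : exists x0 : U, True.
  by have [_ _ _ UL _] := UU; move: Lm; rewrite -UL => -[_ [x _]]; exists x.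
move=> _; pose C x := [set y : U | mdist x y < m].
have m0 : 0 < m := L_pos Lm.
have CP x y : C x = C y <-> mdist x y < m.
  split=> [xy|xy]; first by have : C x y by rewrite xy /C/= mdistxx.
  apply/seteqP; split=> z; rewrite /C/= => zm;
    apply: le_lt_trans (urysohn_ultra UU _ _ _) _; rewrite gt_max; apply/andP.
    by split; [rewrite metric_sym; exact: xy|exact: zm].
  by split; [exact: xy|exact: zm].
have [e eP] := dense_sequence UU x0.
have [z [_ zP]] := urysohn_spread L_pos UU x0 Lm.
have Ccount : (range C #<= [set: nat])%card.
  apply: (@card_le_trans _ _ _ (range (C \o e))); last exact: card_image_le.
  apply: subset_card_le => _ [x _ <-].
  by have [n xn] := eP x m m0; exists n => //=; apply/esym/CP.
have Cinj : {in [set: nat] &, injective (C \o z)}.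
  move=> i j _ _ /CP; have [//|ij] := eqVneq i j.
  by rewrite zP// ltxx.
have Cinf : ([set: nat] #<= range C)%card.
  have /card_eqPle[_ h] := inj_card_eq Cinj.
  apply: card_le_trans h _; apply: subset_card_le => _ [n _ <-].
  by exists (z n).
have /card_set_bijP[f [fT finj fsurj]] : (range C #= [set: nat])%card.
  exact/card_eqPle.
exists (f \o C); split=> [x y|n] /=; last first.
  by have [_ [x _ <-] <-] := fsurj n I; exists x.
rewrite -CP; split=> [/finj|->//].
by apply; rewrite inE; [exists x|exists y].
Qed.

Variable c : U -> nat.
Hypotheses (cP : forall x y, c x = c y <-> mdist x y < m)
  (c_surj : forall n, exists x, c x = n).
Local Notation G := (isometry_group U).

Lemma class_eq_isometry (g : G) x y : c (g x) = c (g y) <-> c x = c y.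
Proof. by rewrite !cP isometry_isometric. Qed.

Lemma mdist_class_neq x y : c x <> c y -> mdist x y = m.
Proof.
move=> xy; apply/eqP; rewrite eq_le urysohn_le_max leNgt.
by apply/negP => /cP.
Qed.

Definition class_rep n : U := sval (cid (c_surj n)).

Lemma class_repK n : c (class_rep n) = n.
Proof. by rewrite /class_rep; case: cid. Qed.

Definition class_perm (g : G) n := c (g (class_rep n)).

Lemma class_permE g x : class_perm g (c x) = c (g x).
Proof. by rewrite /class_perm class_eq_isometry class_repK. Qed.

Lemma class_perm1 n : class_perm 1%g n = n.
Proof. exact: class_repK. Qed.

Lemma class_permM g h n : class_perm (g * h)%g n = class_perm g (class_perm h n).
Proof. by rewrite {3}/class_perm class_permE. Qed.

Lemma class_permK g : cancel (class_perm g) (class_perm g^-1%g).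
Proof. by move=> n; rewrite -class_permM mulVg class_perm1. Qed.

Lemma class_permVK g : cancel (class_perm g^-1%g) (class_perm g).
Proof. by move=> n; rewrite -class_permM mulgV class_perm1. Qed.

Lemma class_perm_inj g : injective (class_perm g).
Proof. exact: can_inj (class_permK g). Qed.

(** Points of different balls are at distance exactly [m] before and after, so the distance is
    preserved across balls whatever the pieces [h n] are. *)
Lemma glue_isometry (h : nat -> G) (rho rho' : nat -> nat) :
  cancel rho rho' -> cancel rho' rho ->
  (forall n, class_perm (h n) n = rho n) ->
  exists g : G, forall x, g x = h (c x) x.
Proof.
move=> rhoK rho'K hrho; pose g x := h (c x) x.
have cg x : c (g x) = rho (c x) by rewrite -hrho class_permE.
have giso : isometric_embedding g.
  move=> x y; have [xy|/eqP xy] := eqVneq (c x) (c y).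
    by rewrite /g xy isometry_isometric.
  rewrite !mdist_class_neq// !cg => /(can_inj rhoK); exact: xy.
have gb : bijective g.
  exists (fun y => (h (rho' (c y)))^-1%g y) => [x|y].
    by rewrite cg rhoK /g [LHS]isometry_invK.
  rewrite /g; set n := rho' (c y).
  have -> : c ((h n)^-1%g y) = n.
    apply: (can_inj rhoK); rewrite -hrho -class_permE.
    have -> : class_perm (h n)^-1%g (c y) = n; last by rewrite hrho.
    apply: (class_perm_inj (g := h n)); rewrite class_permVK hrho.
    by rewrite /n rho'K.
  exact: isometry_invKV.
by exists (Isometry giso gb).
Qed.

Lemma perm_isometry (rho : nat -> nat) : involutive rho ->
  exists g : G, (forall n, class_perm g n = rho n) /\
    forall x, rho (c x) = c x -> g x = x.
Proof.
move=> rhoK.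
(* Taking the identity on every ball that [rho] fixes makes the glued isometry trivial there
   pointwise. *)
have ex_h n : exists h : G, class_perm h n = rho n /\ (rho n = n -> h = 1%g).
  have [rn|/eqP rn] := eqVneq (rho n) n.
    by exists 1%g; rewrite class_perm1 rn.
  have [h hn] := isometry_transitive L_pos UU (class_rep n) (class_rep (rho n)).
  by exists h; split=> //; rewrite /class_perm hn class_repK.
have [h hP] := choice ex_h.
have [g gE] := glue_isometry rhoK rhoK (fun n => (hP n).1).
exists g; split=> [n|x /(hP _).2 hx]; last by rewrite gE hx.
by rewrite /class_perm gE class_repK -(hP n).1.
Qed.

Lemma swap_isometry (k : G) (s : nat) : exists w : G,
  (forall x, c x = s -> w x = k x) /\
  (forall x, c x <> s -> c x <> class_perm k s -> w x = x).
Proof.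
set t := class_perm k s.
pose rho n := if n == s then t else if n == t then s else n.
pose h n := if n == s then k else if n == t then k^-1%g else 1%g.
have rhoK : involutive rho.
  move=> n; rewrite /rho; have [->|ns] := eqVneq n s.
    by have [->|ts] := eqVneq t s; rewrite ?eqxx.
  have [->|nt] := eqVneq n t; first by rewrite eqxx.
  by rewrite (negbTE ns) (negbTE nt).
have hrho n : class_perm (h n) n = rho n.
  rewrite /h /rho; case: eqP => [->//|_]; case: eqP => [->|_].
    exact: class_permK.
  exact: class_perm1.
have [w wE] := glue_isometry rhoK rhoK hrho.
exists w; split=> x; rewrite wE /h; first by move=> ->; rewrite eqxx.
by move=> /eqP/negbTE -> /eqP/negbTE ->.
Qed.

(** The two hypotheses are the only obstructions to imitating [k] on finitely many balls by an
    isometry trivial on [A]. One ball of [s] is corrected at a time. *)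
Lemma agree_fixing (A s : seq nat) (k : G) :
  (forall b, b \in s -> b \notin A -> class_perm k b \notin A) ->
  (forall x, c x \in A -> c x \in s -> k x = x) ->
  exists g : G, (forall x, c x \in A -> g x = x) /\
    forall x, c x \in s -> g x = k x.
Proof.
move=> koff kfix; elim: s koff kfix => [|b s IH] koff kfix.
  by exists 1%g; split.
have [||g [gA gs]] := IH.
- by move=> b' b's; apply: koff; rewrite inE b's orbT.
- by move=> x xA xs; apply: kfix => //; rewrite inE xs orbT.
have [bA|bA] := boolP (b \in A).
  exists g; split=> // x; rewrite inE => /predU1P[xb|]; last exact: gs.
  by rewrite gA ?kfix ?xb// inE eqxx.
(* [w] corrects [g] on ball [b] and moves only the balls [g b] and [k b]. Neither lies in [A], and
   by injectivity neither is the image of another ball of [s]. *)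
have [w [wb w1]] := swap_isometry (k * g^-1)%g (class_perm g b).
have wE x : c x = b -> w (g x) = k x.
  move=> xb; rewrite wb; last by rewrite -class_permE xb.
  by rewrite -[g x]/((g : G) x) /= isometry_invK.
have gbA : class_perm g b \notin A.
  apply/negP => gbA; move/negP: bA; apply.
  have := gA (g (class_rep b)) gbA => ggb.
  have /(congr1 c) : g (class_rep b) = class_rep b.
    by apply: (bij_inj (isometry_bij g)).
  by rewrite class_repK -[X in X = _ -> _]/(class_perm g b) => <-.
have tE : class_perm (k * g^-1)%g (class_perm g b) = class_perm k b.
  by rewrite class_permM class_permK.
have tA : class_perm k b \notin A by apply: koff; rewrite ?inE ?eqxx.
exists (w * g)%g; split=> x.
  move=> xA; rewrite [LHS]/= gA// w1// => xE.
    by move: gbA; rewrite -xE xA.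
  by move: tA; rewrite -tE -xE xA.
rewrite inE => /predU1P[|xs]; first exact: wE.
have [xb|/eqP xb] := eqVneq (c x) b; first exact: wE.
rewrite [LHS]/= w1; first exact: gs.
  by rewrite -class_permE => /class_perm_inj.
by rewrite tE gs// -class_permE => /class_perm_inj.
Qed.

End ball_classes.

(** * Vectors fixed by stabilizers of finitely many balls *)

Section fixed_vectors.
Variables (R : realType) (L : set R) (U : metricType R).
Hypotheses (L_pos : L `<=` [set x | 0 < x]) (UU : ultrametric_urysohn L U).
Variable m : R.
Hypotheses (Lm : L m) (m_max : forall x, L x -> x <= m).
Variable c : U -> nat.
Hypotheses (cP : forall x y, c x = c y <-> mdist x y < m)
  (c_surj : forall n, exists x, c x = n).
Local Notation G := (isometry_group U).
Local Notation class_perm := (class_perm c_surj).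
Variable pi : unitary_rep R G.
Local Notation V := (rep_space pi).
Implicit Types (A B : {fset nat}) (g h k : G) (u v w : V).

Definition fixes A g := forall x, c x \in A -> g x = x.

Definition fixvec A v := forall g, fixes A g -> pi g v = v.

Lemma fixes1 A : fixes A 1%g.
Proof. by []. Qed.

Lemma fixesM A g h : fixes A g -> fixes A h -> fixes A (g * h)%g.
Proof. by move=> gA hA x xA; rewrite [LHS]/= hA// gA. Qed.

Lemma fixesV A g : fixes A g -> fixes A g^-1%g.
Proof. by move=> gA x xA; rewrite -{1}(gA x xA) [LHS]isometry_invK. Qed.

Lemma fixesS A B g : {subset A <= B} -> fixes B g -> fixes A g.
Proof. by move=> AB gB x /AB; exact: gB. Qed.

Lemma fixes_perm A g n : fixes A g -> n \in A -> class_perm g n = n.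
Proof.
by move=> gA nA; rewrite /class_perm gA class_repK.
Qed.

Lemma fixes_perm_notin A g n : fixes A g -> n \notin A -> class_perm g n \notin A.
Proof.
move=> gA; apply: contra => gnA.
by have := fixes_perm gA gnA => /(class_perm_inj cP) <-.
Qed.

Lemma rep_rdot g u v : rdot (pi g u) (pi g v) = rdot u v.
Proof. by rewrite /rdot rep_unitary. Qed.

Lemma rep_rnorm g u : rnorm (pi g u) = rnorm u.
Proof.
by apply/eqP; rewrite -(@eqrXn2 _ 2) ?rnorm_ge0// -!rdotvv rep_rdot.
Qed.

Lemma rep_rdotV g u v : rdot (pi g u) v = rdot u (pi g^-1%g v).
Proof. by rewrite -(rep_rdot g^-1%g) -rep_actM mulVg rep_act1. Qed.

Lemma fixvecD A u v : fixvec A u -> fixvec A v -> fixvec A (u + v).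
Proof. by move=> uA vA g gA; rewrite linearD uA// vA. Qed.

Lemma fixvecN A u : fixvec A u -> fixvec A (- u).
Proof. by move=> uA g gA; rewrite linearN uA. Qed.

Lemma fixvecS A B v : {subset A <= B} -> fixvec A v -> fixvec B v.
Proof. by move=> AB vA g /(fixesS AB); exact: vA. Qed.

Lemma fixvec_act A g v : fixvec A v ->
  fixvec [fset class_perm g n | n in A]%fset (pi g v).
Proof.
move=> vA h hgA.
have : fixes A (g^-1 * h * g)%g.
  move=> x xA; rewrite [LHS]/=.
  rewrite -[g x]/((g : G) x) hgA; first exact: isometry_invK.
  by apply/imfsetP; exists (c x) => //=; rewrite (class_permE cP c_surj).
move=> /vA; rewrite -!mulgA rep_actM => /(congr1 (pi g)).
by rewrite -!rep_actM !mulgA mulgV mul1g rep_actM.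
Qed.

(** Midpoints replace convex combinations: the minimal norm point asks for no more, and each
    property of the hull becomes a two-case induction. *)
Inductive hull A v : V -> Prop :=
| hull_orbit g of fixes A g : hull A v (pi g v)
| hull_mid x y of hull A v x & hull A v y : hull A v (2^-1 *: (x + y)).

Lemma hull_neq0 A v : exists x, hull A v x.
Proof. by exists (pi 1%g v); by apply: hull_orbit; exact: fixes1. Qed.

Lemma hull_act A v g x : fixes A g -> hull A v x -> hull A v (pi g x).
Proof.
move=> gA; elim=> [h hA|y z _ Hy _ Hz].
  by rewrite -rep_actM; apply/hull_orbit/fixesM.
by rewrite linearZ linearD; exact: hull_mid.
Qed.

Definition proj A v : V := min_norm_pt (hull_neq0 A v) (@hull_mid A v).

Lemma proj_fixvec A v : fixvec A (proj A v).
Proof.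
move=> g gA; apply: min_norm_pt_fixed => [x|x].
  exact: rep_rdot.
exact: hull_act.
Qed.

Lemma hull_rdot A v w x : fixvec A w -> hull A v x -> rdot x w = rdot v w.
Proof.
move=> wA; elim=> [g gA|y z _ Hy _ Hz].
  by rewrite rep_rdotV wA//; exact: fixesV.
by rewrite rdot_half rdotDl Hy Hz; field.
Qed.

(** The product with a vector fixed by the stabilizer is constant on the hull, and [proj A v] is a
    limit of points of the hull. *)
Lemma proj_orth A v w : fixvec A w -> rdot (v - proj A v) w = 0.
Proof.
move=> wA; apply/eqP; rewrite -normr_le0; apply/ler_addgt0Pl => e e0.
rewrite addr0; pose N := rnorm w + 1.
have N0 : 0 < N by rewrite ltr_wpDl ?rnorm_ge0.
have eN0 : 0 < e / N by rewrite divr_gt0.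
have [x Ax xe] := min_norm_pt_adherent (hull_neq0 A v) (@hull_mid A v) eN0.
have -> : rdot (v - proj A v) w = rdot (x - proj A v) w.
  by rewrite !rdotBl (hull_rdot wA Ax).
have key z : rnorm z < e / N -> rdot z w <= e.
  move=> ze; rewrite (le_trans (rdot_le _ _))//.
  rewrite -[leRHS](divfK (lt0r_neq0 N0)) ler_pM ?rnorm_ge0 ?ltW//.
  by rewrite ltrDl.
by rewrite ler_norml lerNl -rdotNl !key// ?rnormN// rnormBC.
Qed.

Lemma proj_close A v e : (forall g, fixes A g -> rnorm (v - pi g v) <= e) ->
  rnorm (v - proj A v) <= e.
Proof.
move=> ve; have hull_e x : hull A v x -> rnorm (v - x) <= e.
  elim=> [g|y z _ Hy _ Hz]; first exact: ve.
  have -> : v - 2^-1 *: (y + z) = 2^-1 *: ((v - y) + (v - z)).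
    rewrite addrACA -opprD [RHS]scalerBr; congr (_ - _).
    by rewrite scalerDr -scalerDl -div1r -splitr scale1r.
  have -> u : rnorm (2^-1 *: u) = rnorm u / 2.
    rewrite /rnorm normrZ gtr0_norm// rnormE.
    have -> : (2^-1 : R[i]) = (2^-1)%:C%C by rewrite fmorphV rmorph_nat.
    by rewrite -rmorphM/= mulrC.
  by have := rnormD (v - y) (v - z); lra.
apply/ler_addgt0Pr => d d0.
have [x Ax xd] := min_norm_pt_adherent (hull_neq0 A v) (@hull_mid A v) d0.
rewrite (le_trans (rnorm_triangle x _ _))// lerD// ?hull_e//.
by rewrite rnormBC ltW.
Qed.

(** The stabilizers of finite sets of balls form a filter converging to the identity, so continuity
    at the identity finds one that moves [v] by at most [e]; then the whole hull of [v] stays within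
    [e]. *)
Lemma proj_dense v e : 0 < e -> exists A, rnorm (v - proj A v) <= e.
Proof.
move=> e0.
pose F := filter_from [set: {fset nat}] (fun A => [set g | fixes A g]).
have FF : Filter F.
  apply: filter_from_filter; first by exists fset0.
  move=> A B _ _; exists (A `|` B)%fset => // g gAB.
  by split; apply: fixesS gAB => n; rewrite inE => ->; rewrite ?orbT.
have F1 : F --> (1%g : G).
  apply/isometry_cvgP => x P xP.
  exists [fset c x]%fset => // g gx; rewrite /= gx ?inE//.
  exact: nbhs_singleton.
have e0C : 0 < e%:C%C by rewrite ltcR.
have [A _ Ae] : F [set g | ball (pi 1%g v) e%:C%C (pi g v)].
  apply: F1; apply: (@rep_continuous _ _ pi v 1%g); exact: nbhsx_ballx.
exists A; apply: proj_close => g /Ae/=.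
by rewrite -ball_normE/= rep_act1 rnormE ltcR => /ltW.
Qed.

Lemma shift_away A0 A (F : seq nat) : {subset A0 <= A} ->
  exists h, fixes A0 h /\
    forall n, n \in F -> n \notin A0 -> class_perm h n \notin A.
Proof.
move=> A0A; pose N := (\max_(n <- F ++ A) n).+1.
have ltN n : n \in F ++ A -> (n < N)%N.
  by move=> nF; rewrite ltnS; apply: leq_bigmax_seq.
have A0N n : n \in A0 -> (n < N)%N.
  by move=> /A0A nA; rewrite ltN// mem_cat nA orbT.
(* [N] exceeds all labels in [F] and [A]: each label below [N] outside [A0] is exchanged with its
   translate by [N], which avoids [A]. *)
pose rho n := if n \in A0 then n else if (n < N)%N then (n + N)%N
  else if (n < N + N)%N && ((n - N)%N \notin A0) then (n - N)%N else n.
have ltNA0 n : (N <= n)%N -> n \in A0 = false.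
  by move=> Nn; apply/negP => /A0N; rewrite ltnNge Nn.
have rhoK : involutive rho.
  move=> n; rewrite /rho; have [nA0|nA0] := boolP (n \in A0); first by rewrite nA0.
  have [nN|Nn] := ltnP n N.
    rewrite (ltNA0 (n + N)%N) ?leq_addl// ltnNge leq_addl/=.
    by rewrite ltn_add2r nN addnK nA0.
  have [/andP[nNN nNA0]|nNN] := boolP ((n < N + N)%N && ((n - N)%N \notin A0)).
    by rewrite (negbTE nNA0) ltn_subLR// nNN subnK.
  by rewrite (negbTE nA0) ltnNge Nn/= (negbTE nNN).
have [h [hrho hfix]] := perm_isometry L_pos UU Lm m_max cP c_surj rhoK.
exists h; split=> [x xA0|n nF nA0]; first by apply: hfix; rewrite /rho xA0.
rewrite hrho /rho (negbTE nA0) ltN ?mem_cat ?nF//.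
apply/negP => nA; have := @ltN (n + N)%N; rewrite mem_cat nA orbT.
by rewrite ltnNge leq_addl => /(_ isT).
Qed.

(** On an orbit point [pi k v] the finite set to move away is [k] applied to [B]: then [h * k] can
    be imitated on [B] by an isometry trivial on [A]. Midpoints only enlarge the finite set, so one
    [h] serves all orbit points involved in [x]. *)
Lemma hull_shift A B v x : fixvec B v -> hull (A `&` B)%fset v x ->
  exists F : seq nat, forall h, fixes (A `&` B)%fset h ->
    (forall n, n \in F -> n \notin (A `&` B)%fset -> class_perm h n \notin A) ->
    hull A v (pi h x).
Proof.
move=> vB; elim=> [k kAB|y z _ [F1 HF1] _ [F2 HF2]]; last first.
  exists (F1 ++ F2) => h hAB hF; rewrite linearZ linearD; apply: hull_mid.
    by apply: HF1 => // n nF; apply: hF; rewrite mem_cat nF.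
  by apply: HF2 => // n nF; apply: hF; rewrite mem_cat nF orbT.
exists [seq class_perm k b | b <- B] => h hAB hF.
have [||g [gA gB]] := @agree_fixing R L U L_pos UU m Lm m_max c cP c_surj A B (h * k)%g.
- move=> b bB bA; rewrite (class_permM cP c_surj); apply: hF; first exact: map_f.
  by apply: fixes_perm_notin; rewrite // inE negb_and bA.
- by move=> y yA yB; apply: (fixesM hAB kAB); rewrite inE yA.
rewrite -rep_actM.
(* [g] and [h * k] agree on the balls of [B], so they differ by an isometry that fixes [v]. *)
have -> : pi (h * k)%g v = pi g v; last exact: hull_orbit.
rewrite -[(h * k)%g](mulVKg g) rep_actM vB// => y yB.
rewrite [LHS]/= -[h (k y)]/((h * k)%g y) -gB//; exact: isometry_invK.
Qed.

(* The two hulls have the same infimum norm because an isometry of [A & B] that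
   moves a finite set of balls off [A] carries a point of the larger hull into
   the smaller one. *)
Lemma proj_meet A B v : fixvec B v -> fixvec (A `&` B)%fset (proj A v).
Proof.
move=> vB; suff -> : proj A v = proj (A `&` B)%fset v by exact: proj_fixvec.
have ABA : {subset (A `&` B)%fset <= A} by move=> n; rewrite inE => /andP[].
apply/esym/min_norm_pt_eq => [x|x /(hull_shift vB)[F HF]].
  elim=> [g gA|y z _ Hy _ Hz]; last exact: hull_mid.
  by apply: hull_orbit; exact: fixesS gA.
have [h [hAB hF]] := shift_away F ABA.
by exists (pi h x); [exact: HF|exact: rep_rdot].
Qed.

End fixed_vectors.

(** * Orthogonal decomposition of fixed vectors *)

Section pure_vectors.
Variables (R : realType) (L : set R) (U : metricType R).
Hypotheses (L_pos : L `<=` [set x | 0 < x]) (UU : ultrametric_urysohn L U).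
Variable m : R.
Hypotheses (Lm : L m) (m_max : forall x, L x -> x <= m).
Variable c : U -> nat.
Hypotheses (cP : forall x y, c x = c y <-> mdist x y < m)
  (c_surj : forall n, exists x, c x = n).
Local Notation G := (isometry_group U).
Local Notation class_perm := (class_perm c_surj).
Variable pi : unitary_rep R G.
Local Notation V := (rep_space pi).
Local Notation fixvec := (fixvec c (pi := pi)).
Local Notation proj := (proj c (pi := pi)).
Implicit Types (A B C D : {fset nat}) (g h k : G) (u v w : V).

(** This is the subspace K_C: the part of the vectors fixed by the stabilizer of [C] that comes from
    no smaller set. *)
Definition pure C w := fixvec C w /\
  forall D, (D `<` C)%fset -> forall y, fixvec D y -> rdot w y = 0.

Lemma pure0 C : pure C 0.
Proof. by split=> [g _|D _ y _]; [rewrite linear0|rewrite rdot0l]. Qed.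

Lemma pureD C u v : pure C u -> pure C v -> pure C (u + v).
Proof.
move=> [uC uD] [vC vD]; split=> [|D DC y yD]; first exact: fixvecD.
by rewrite rdotDl (uD _ DC _ yD) (vD _ DC _ yD) addr0.
Qed.

Lemma pureN C u : pure C u -> pure C (- u).
Proof.
move=> [uC uD]; split=> [|D DC y yD]; first exact: fixvecN.
by rewrite rdotNl (uD _ DC _ yD) oppr0.
Qed.

(** If [D] is not contained in [C], then [u] may be replaced by its projection for [D], which by
    [proj_meet] already comes from the proper subset [D & C] of [D]. *)
Lemma pure_orth C D u v : pure C u -> pure D v -> C != D -> rdot u v = 0.
Proof.
wlog DC : C D u v / ~~ (D `<=` C)%fset => [hw|[uC _] [vD vorth] _].
  move=> uC vD CD; have [DC|] := boolP (D `<=` C)%fset; last first.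
    by move=> nDC; exact: (hw C D).
  rewrite rdotC; apply: (hw D C); rewrite // 1?eq_sym//.
  by apply: contra CD => CD; rewrite eqEfsubset CD.
have := proj_orth u vD; rewrite rdotBl => /subr0_eq ->.
rewrite rdotC; apply: (vorth (D `&` C)%fset).
  by rewrite fproperE fsubsetIl/=; apply: contra DC; rewrite fsubsetI => /andP[].
exact: (proj_meet L_pos UU Lm m_max cP c_surj).
Qed.

Lemma class_perm_imfsetK g C :
  [fset class_perm g^-1%g n | n in [fset class_perm g n | n in C]]%fset = C.
Proof.
apply/fsetP => n; apply/imfsetP/idP => [[_ /imfsetP[k kC ->] ->]|nC].
  by rewrite (class_permK cP).
exists (class_perm g n); last by rewrite (class_permK cP).
by apply/imfsetP; exists n.
Qed.

Lemma pure_act C g w : pure C w ->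
  pure [fset class_perm g n | n in C]%fset (pi g w).
Proof.
move=> [wC worth]; split=> [|D DgC y yD]; first exact: (fixvec_act cP wC).
rewrite rep_rdotV.
apply: (worth [fset class_perm g^-1%g n | n in D]%fset); last exact: (fixvec_act cP yD).
have imS (h : G) (X Y : {fset nat}) : (X `<=` Y)%fset ->
    ([fset class_perm h n | n in X] `<=` [fset class_perm h n | n in Y])%fset.
  move=> /fsubsetP XY; apply/fsubsetP => _ /imfsetP[k kX ->].
  by apply/imfsetP; exists k => //; exact: XY.
move: DgC; rewrite !fproperE => /andP[DgC gCD]; apply/andP; split.
  by rewrite -[X in (_ `<=` X)%fset](class_perm_imfsetK g); exact: imS.
apply: contra gCD => /(imS g).
by have := class_perm_imfsetK g^-1%g D; rewrite invgK => ->.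
Qed.

Lemma pure_sum_norm (r : seq {fset nat}) (w : {fset nat} -> V) : uniq r ->
  (forall C, pure C (w C)) ->
  rdot (\sum_(C <- r) w C) (\sum_(C <- r) w C) = \sum_(C <- r) rdot (w C) (w C).
Proof.
move=> ru wp; rewrite rdot_suml; apply: eq_big_seq => C Cr.
rewrite rdot_sumr (bigD1_seq C)//= big1 ?addr0// => D DC.
by apply: (pure_orth (wp C) (wp D)); rewrite eq_sym.
Qed.

Lemma sum_fpowerset_supp (M : nmodType) (F : {fset nat} -> M) A B :
  (A `<=` B)%fset -> (forall C, ~~ (C `<=` A)%fset -> F C = 0) ->
  \sum_(C <- fpowerset A) F C = \sum_(C <- fpowerset B) F C.
Proof.
move=> AB F0; apply: big_fset_incl => [|C _].
  by apply/fsubsetP => C; rewrite !fpowersetE => /fsubset_trans; exact.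
by rewrite fpowersetE => /F0.
Qed.

Definition decomposable B v := exists w : {fset nat} -> V,
  [/\ forall C, pure C (w C), forall C, ~~ (C `<=` B)%fset -> w C = 0
    & v = \sum_(C <- fpowerset B) w C].

Lemma decomposableD B u v :
  decomposable B u -> decomposable B v -> decomposable B (u + v).
Proof.
move=> [w [wp w0 ->]] [w' [w'p w'0 ->]]; exists (fun C => w C + w' C).
split=> [C|C CB|]; first exact: pureD; first by rewrite w0// w'0// addr0.
by rewrite big_split.
Qed.

Lemma decomposableS A B v : (A `<=` B)%fset ->
  decomposable A v -> decomposable B v.
Proof.
move=> AB [w [wp w0 ->]]; exists w; split=> // [C CB|].
  by apply: w0; apply: contra CB => /fsubset_trans; exact.
exact: sum_fpowerset_supp.
Qed.

Lemma decomposable_pure B v : pure B v -> decomposable B v.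
Proof.
move=> vB; exists (fun C => if C == B then v else 0); split=> [C|C|].
- by case: eqP => [->//|_]; exact: pure0.
- by apply: contraNeq; case: (C =P B) => [->|]; rewrite ?eqxx.
rewrite (bigD1_seq B) ?fset_uniq ?fpowersetE//= eqxx big1 ?addr0// => C.
by move=> /negbTE ->.
Qed.

(** A Gram-Schmidt process: the projections to the sets [B] minus one point are subtracted in turn,
    and each subtracted piece is decomposable by induction. *)
Lemma peel B (l : seq nat) v :
  (forall A w, (A `<` B)%fset -> fixvec A w -> decomposable A w) ->
  {subset l <= B} -> fixvec B v ->
  exists x, [/\ fixvec B x, decomposable B (v - x) &
    {in l, forall b y, fixvec (B `\ b)%fset y -> rdot x y = 0}].
Proof.
move=> IH lB vB; elim: l lB => [|b l IHl] lB.
  by exists v; split=> //; rewrite subrr; apply/decomposable_pure/pure0.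
have [|x [xB vx xl]] := IHl; first by move=> n nl; rewrite lB// inE nl orbT.
have bB : b \in B by rewrite lB// inE eqxx.
pose A := (B `\ b)%fset; pose u := proj A x.
have meetA (D : {fset nat}) y : fixvec D y -> fixvec (A `&` D)%fset (proj A y).
  exact: (proj_meet L_pos UU Lm m_max cP c_surj).
have uA : fixvec A u by exact: proj_fixvec.
have AB : (A `<` B)%fset by exact: fproperD1.
exists (x - u); split.
- apply: fixvecD => //; apply: fixvecN; apply: fixvecS uA.
  by apply/fsubsetP; exact: fproper_sub.
- rewrite opprB addrCA addrC; apply: decomposableD => //.
  by apply: (decomposableS (fproper_sub AB)); exact: IH.
- move=> d; rewrite inE => /predU1P[->|dl] y yd; first exact: proj_orth.
  (* Earlier orthogonality survives: with P the projection for [A], the products of [u] and [y], of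
     [u] and P y, and of [x] and P y coincide. By [proj_meet] the vector P y is still fixed by the
     stabilizer of [B] minus [d], so the last product vanishes. *)
  rewrite rdotBl (xl _ dl _ yd) sub0r; apply/eqP; rewrite oppr_eq0; apply/eqP.
  have pyD := meetA _ _ yd.
  have := proj_orth y uA; rewrite rdotBl => /subr0_eq; rewrite rdotC => ->.
  rewrite rdotC.
  have pyA : fixvec A (proj A y) by exact: proj_fixvec.
  have := proj_orth x pyA; rewrite rdotBl => /subr0_eq <-.
  apply: (xl d dl); apply: fixvecS pyD => n.
  by rewrite inE => /andP[].
Qed.

Lemma fixvec_decomposable B v : fixvec B v -> decomposable B v.
Proof.
have [n] := ubnP #|` B|; elim: n B v => // n IHn B v Bn vB.
have [| | |x [xB vx xorth]] := @peel B B v; [|by []|by []|].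
  move=> A w AB; apply: IHn; rewrite -ltnS.
  by apply: leq_ltn_trans (fproper_ltn_card AB) _.
rewrite -(subrK x v); apply: decomposableD => //.
apply: decomposable_pure; split=> // D DB y yD.
(* Every proper subset lies in [B] minus a point, so orthogonality for those maximal subsets
   suffices. *)
move: DB; rewrite fproperE => /andP[DB /fsubsetPn[b bB bD]].
apply: (xorth b bB); apply: fixvecS yD; apply/fsubsetP.
by rewrite fsubsetD1 DB.
Qed.

End pure_vectors.

(** * The spectral gap *)

Section share.
Variable R : realType.
Implicit Types (C : {fset nat}) (T : pred nat).

(* Equal to [0] when [C] is empty. *)
Definition share T C : R := (count T C)%:R / #|` C|%:R.

Lemma share_ge0 T C : 0 <= share T C.
Proof. by rewrite divr_ge0. Qed.

Lemma share_le1 T C : share T C <= 1.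
Proof.
rewrite /share; have [->|C0] := eqVneq #|` C| 0%N; first by rewrite invr0 mulr0.
by rewrite ler_pdivrMr ?ltr0n ?lt0n// mul1r ler_nat count_size.
Qed.

Lemma share_imfset (rho : nat -> nat) T C : injective rho ->
  share T [fset rho n | n in C]%fset = share (T \o rho) C.
Proof.
move=> rho_inj; rewrite /share card_imfset//; congr (_%:R / _).
rewrite -[RHS]count_map.
suff /seq.permP -> : perm_eq [fset rho n | n in C]%fset [seq rho n | n <- C] by [].
apply: uniq_perm; first exact: fset_uniq.
  by rewrite map_inj_uniq// fset_uniq.
by move=> n; apply/imfsetP/mapP => -[k kC ->]; exists k.
Qed.

Lemma shareU T T' C : (forall n, ~~ (T n && T' n)) ->
  share (predU T T') C = share T C + share T' C.
Proof.
move=> TT'; rewrite /share -mulrDl -natrD; congr (_%:R / _).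
rewrite -count_predUI [X in (_ + X)%N](eq_count (a2 := pred0)) ?count_pred0 ?addn0//.
by move=> n; apply/negbTE/TT'.
Qed.

Lemma share_full T C : (forall n, T n) -> C != fset0 -> share T C = 1.
Proof.
move=> Tn C0; rewrite /share (eq_count (a2 := predT)) ?count_predT//.
by rewrite divff// pnatr_eq0 cardfs_eq0.
Qed.

End share.

(** The paradox: invariance under [swap01] and [swap12] gives the three residue classes modulo 3
    equal mass, whereas [swap2] gives class 2 the mass of classes 0 and 1 together. All masses must
    then vanish. The map [swap2] pairs 3q + r, for r < 2, with 3(2q + r) + 2. *)
Definition swap01 n : nat :=
  if (n %% 3 == 0)%N then n.+1 else if (n %% 3 == 1)%N then n.-1 else n.

Definition swap12 n : nat :=
  if (n %% 3 == 1)%N then n.+1 else if (n %% 3 == 2)%N then n.-1 else n.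

(* Exchanges the class of 2 modulo 3 with its complement. *)
Definition swap2 n : nat :=
  if (n %% 3 == 2)%N then (3 * (n %/ 3 %/ 2) + (n %/ 3) %% 2)%N
  else (3 * (2 * (n %/ 3) + n %% 3) + 2)%N.

Lemma swap01K : involutive swap01.
Proof. by move=> n; rewrite /swap01; do ?case: ifP => /eqP; lia. Qed.

Lemma swap12K : involutive swap12.
Proof. by move=> n; rewrite /swap12; do ?case: ifP => /eqP; lia. Qed.

Lemma swap2K : involutive swap2.
Proof. by move=> n; rewrite /swap2; do ?case: ifP => /eqP; lia. Qed.

Lemma swap01_mod n : (swap01 n %% 3 == 0)%N = (n %% 3 == 1)%N.
Proof. by rewrite /swap01; do ?case: ifP => /eqP; lia. Qed.

Lemma swap12_mod n : (swap12 n %% 3 == 1)%N = (n %% 3 == 2)%N.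
Proof. by rewrite /swap12; do ?case: ifP => /eqP; lia. Qed.

Lemma swap2_mod n : (swap2 n %% 3 == 2)%N = (n %% 3 == 0)%N || (n %% 3 == 1)%N.
Proof. by rewrite /swap2; do ?case: ifP => /eqP; lia. Qed.

Section spectral_gap.
Variables (R : realType) (L : set R) (U : metricType R).
Hypotheses (L_pos : L `<=` [set x | 0 < x]) (UU : ultrametric_urysohn L U).
Variable m : R.
Hypotheses (Lm : L m) (m_max : forall x, L x -> x <= m).
Variable c : U -> nat.
Hypotheses (cP : forall x y, c x = c y <-> mdist x y < m)
  (c_surj : forall n, exists x, c x = n).
Local Notation G := (isometry_group U).
Local Notation class_perm := (class_perm c_surj).
Variable pi : unitary_rep R G.
Local Notation V := (rep_space pi).
Local Notation fixvec := (fixvec c (pi := pi)).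
Local Notation pure := (pure c (pi := pi)).
Implicit Types (A B C D : {fset nat}) (g h k : G) (u v : V).

Section mass.
Variables (A : {fset nat}) (w : {fset nat} -> V).
Hypotheses (w_pure : forall C, pure C (w C))
  (w_supp : forall C, ~~ (C `<=` A)%fset -> w C = 0).

Let v : V := \sum_(C <- fpowerset A) w C.

Definition mass (T : pred nat) : R :=
  \sum_(C <- fpowerset A) rdot (w C) (w C) * share R T C.

(** The displacement of [v] controls the change of its component norms, hence of the mass. The
    parameter [M] lets the caller trade the displacement term against a small multiple of the
    squared norm of [v]. *)
Lemma mass_move g (T : pred nat) (M : R) : 0 < M -> involutive (class_perm g) ->
  `|mass (T \o class_perm g) - mass T| <=
    M * rdot (pi g v - v) (pi g v - v) + rdot v v / M.
Proof.
move=> M0; set rho := class_perm g => rhoK.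
pose s C := [fset rho n | n in C]%fset.
have sK : involutive s.
  move=> C; apply/fsetP => n; apply/imfsetP/idP => [[_ /imfsetP[k kC ->] ->]|nC].
    by rewrite rhoK.
  by exists (rho n); [apply/imfsetP; exists n|rewrite rhoK].
have sS (X Y : {fset nat}) : (X `<=` Y)%fset -> (s X `<=` s Y)%fset.
  move=> /fsubsetP XY; apply/fsubsetP => _ /imfsetP[k kX ->].
  by apply/imfsetP; exists k => //; exact: XY.
(* As [rho] is an involution, [W] is stable under it, so [s] permutes the subsets of [W] and both
   masses become sums over one index set. *)
pose W := (A `|` s A)%fset.
have AW : (A `<=` W)%fset by exact: fsubsetUl.
have sW : (s W `<=` W)%fset.
  apply/fsubsetP => _ /imfsetP[k + ->]; rewrite !inE => /orP[kA|/imfsetP[n nA ->]].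
    by apply/orP; right; apply/imfsetP; exists k.
  by rewrite rhoK nA.
pose Om := fpowerset W.
have sOm C : (s C \in Om) = (C \in Om).
  rewrite !fpowersetE; apply/idP/idP => [/sS|/sS] CW.
    by move: CW; rewrite sK => /fsubset_trans; exact.
  exact: fsubset_trans CW sW.
have reindexOm (M' : nmodType) (F : {fset nat} -> M') :
    \sum_(C <- Om) F (s C) = \sum_(C <- Om) F C.
  rewrite -(big_map s xpredT F); apply: perm_big; apply: uniq_perm.
  - by rewrite map_inj_uniq ?fset_uniq//; exact: inv_inj.
  - exact: fset_uniq.
  - move=> C; apply/mapP/idP => [[D DOm ->]|COm]; first by rewrite sOm.
    by exists (s C); rewrite ?sOm ?sK.
pose a C := rnorm (w C).
have vE : v = \sum_(C <- Om) w C by exact: sum_fpowerset_supp.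
have vvE : rdot v v = \sum_(C <- Om) a C ^+ 2.
  rewrite vE (pure_sum_norm L_pos UU Lm m_max cP c_surj)// ?fset_uniq//.
  by apply: eq_bigr => C _; rewrite rdotvv.
have massE T' : mass T' = \sum_(C <- Om) a C ^+ 2 * share R T' C.
  rewrite /mass (sum_fpowerset_supp AW) => [|C /w_supp ->].
    by apply: eq_bigr => C _; rewrite rdotvv.
  by rewrite rdot0l mul0r.
(* So the component of [pi g v] at [C] is the image of the component of [v] at [s C]. *)
have gw_pure C : pure C (pi g (w (s C))).
  have := pure_act cP c_surj g (w_pure (s C)).
  by rewrite -/(s (s C)) sK.
have deltaE : rdot (pi g v - v) (pi g v - v) =
    \sum_(C <- Om) rdot (pi g (w (s C)) - w C) (pi g (w (s C)) - w C).
  have -> : pi g v - v = \sum_(C <- Om) (pi g (w (s C)) - w C).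
    by rewrite big_split/= sumrN -vE (reindexOm V (fun C => pi g (w C))) vE linear_sum.
  rewrite (pure_sum_norm L_pos UU Lm m_max cP c_surj) ?fset_uniq// => C.
  by apply: pureD; [exact: gw_pure|exact: pureN].
have delta_ge : \sum_(C <- Om) (a (s C) - a C) ^+ 2 <=
    rdot (pi g v - v) (pi g v - v).
  rewrite deltaE; apply: ler_sum => C _; rewrite rdotvv.
  have h1 := rnormD (pi g (w (s C)) - w C) (w C).
  have h2 := rnormD (w C - pi g (w (s C))) (pi g (w (s C))).
  rewrite !subrK in h1 h2; rewrite rnormBC in h2.
  rewrite rep_rnorm -/(a _) -/(a _) in h1 h2.
  rewrite -real_normK ?num_real// ler_pXn2r ?nnegrE ?normr_ge0 ?rnorm_ge0//.
  by rewrite ler_norml; apply/andP; split; lra.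
have -> : mass (T \o rho) = \sum_(C <- Om) a (s C) ^+ 2 * share R T C.
  rewrite massE -(reindexOm R (fun C => a (s C) ^+ 2 * share R T C)).
  apply: eq_bigr => C _; rewrite sK share_imfset//.
  exact: inv_inj.
rewrite massE -sumrB (le_trans (ler_norm_sum _ _ _))//.
(* AM-GM: [|x^2 - y^2| <= M (x - y)^2 + (x^2 + y^2) / (2 M)] *)
have termle C : `|a (s C) ^+ 2 * share R T C - a C ^+ 2 * share R T C| <=
    M * (a (s C) - a C) ^+ 2 + (a (s C) ^+ 2 + a C ^+ 2) / (2 * M).
  rewrite -mulrBl normrM (ger0_norm (share_ge0 _ _ _)).
  apply: (@le_trans _ _ `|a (s C) ^+ 2 - a C ^+ 2|).
    by rewrite ler_piMr// share_le1.
  set x := a (s C); set y := a C.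
  have MV0 : 0 < M^-1 by rewrite invr_gt0.
  have MM : M * M^-1 = 1 by rewrite divff// gt_eqF.
  rewrite invfM; set N := M^-1 in MV0 MM *.
  have key (p q : R) : p * q <= M * p ^+ 2 + q ^+ 2 * N / 4.
    have : 0 <= M * (p - q * N / 2) ^+ 2 by rewrite mulr_ge0 ?sqr_ge0// ltW.
    have -> : M * (p - q * N / 2) ^+ 2 =
       M * p ^+ 2 - p * q * (M * N) + q ^+ 2 * N * (M * N) / 4 by field.
    by rewrite MM; lra.
  have h1 := key (x - y) (x + y); have h2 := key (y - x) (x + y).
  have sq0 : 0 <= (x - y) ^+ 2 * N by rewrite mulr_ge0 ?sqr_ge0 ?ltW.
  by rewrite ler_norml; apply/andP; split; nra.
apply: (le_trans (ler_sum _ (fun C _ => termle C))).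
rewrite big_split/= -mulr_sumr lerD//; first by rewrite ler_pM2l.
rewrite -mulr_suml big_split/= (reindexOm R (fun C => a C ^+ 2)) -vvE.
by rewrite invfM mulrA -mulr2n -[_ *+ 2]mulr_natr mulfK.
Qed.

End mass.

Lemma fixvec_gap A (g0 g1 g2 : G) v :
  (forall u, (forall g, pi g u = u) -> u = 0) ->
  class_perm g0 =1 swap01 -> class_perm g1 =1 swap12 -> class_perm g2 =1 swap2 ->
  fixvec A v ->
  rdot v v <= 144 * (rdot (pi g0 v - v) (pi g0 v - v) +
    rdot (pi g1 v - v) (pi g1 v - v) + rdot (pi g2 v - v) (pi g2 v - v)).
Proof.
move=> noinv /funext g0E /funext g1E /funext g2E vA.
have [w [wp ws vE]] := fixvec_decomposable L_pos UU Lm m_max cP c_surj vA.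
(* Every isometry fixes the empty set of balls, so this component is invariant. Its share is 0, and
   only its vanishing makes the total mass equal to [rdot v v]. *)
have w0 : w fset0 = 0.
  by apply: noinv => g; apply: (wp fset0).1 => x; rewrite inE.
pose T i := [pred n | n %% 3 == i]%N.
(* With errors e0, e1, e2 for the three involutions, the total mass is at most 2 e0 + 4 e1 + 3 e2.
   The nine copies of [rdot v v / 18] make one half of [rdot v v], which is absorbed on the left;
   the largest remaining coefficient is 2 * 4 * 18 = 144. *)
have M0 : 0 < 18 :> R by [].
have := mass_move wp ws (g := g0) (T 0%N) M0.
have := mass_move wp ws (g := g1) (T 1%N) M0.
have := mass_move wp ws (g := g2) (T 2%N) M0.
rewrite g0E g1E g2E -vE => /(_ swap2K) h2 /(_ swap12K) h1 /(_ swap01K) h0.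
have eq_mass T1 T2 : T1 =1 T2 -> mass A w T1 = mass A w T2.
  by move=> /funext ->.
rewrite (eq_mass _ (T 1%N)) in h0; last by move=> n /=; exact: swap01_mod.
rewrite (eq_mass _ (T 2%N)) in h1; last by move=> n /=; exact: swap12_mod.
rewrite (eq_mass _ (predU (T 0%N) (T 1%N))) in h2; last first.
  by move=> n /=; exact: swap2_mod.
have massU T1 T2 : (forall n, ~~ (T1 n && T2 n)) ->
    mass A w (predU T1 T2) = mass A w T1 + mass A w T2.
  move=> T12; rewrite /mass -big_split; apply: eq_bigr => C _.
  by rewrite shareU// mulrDr.
have full : mass A w (predU (predU (T 0%N) (T 1%N)) (T 2%N)) = rdot v v.
  rewrite vE (pure_sum_norm L_pos UU Lm m_max cP c_surj) ?fset_uniq//.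
  apply: eq_bigr => C _; have [->|C0] := eqVneq C fset0.
    by rewrite w0 rdot0l mul0r.
  by rewrite share_full ?mulr1// => n; rewrite /T/=; lia.
rewrite massU in full; last by move=> n; rewrite /T/=; lia.
rewrite massU in full h2; last by move=> n; rewrite /T/=; lia.
move: h0 h1 h2; rewrite !ler_norml.
have := rdot_ge0 (pi g0 v - v); have := rdot_ge0 (pi g2 v - v).
by move=> ? ? /andP[? ?] /andP[? ?] /andP[? ?]; lra.
Qed.

Lemma rep_gap (g0 g1 g2 : G) v :
  (forall u, (forall g, pi g u = u) -> u = 0) ->
  class_perm g0 =1 swap01 -> class_perm g1 =1 swap12 -> class_perm g2 =1 swap2 ->
  rdot v v <= 432 * (rdot (pi g0 v - v) (pi g0 v - v) +
    rdot (pi g1 v - v) (pi g1 v - v) + rdot (pi g2 v - v) (pi g2 v - v)).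
Proof.
move=> noinv g0E g1E g2E.
pose d g u := rnorm (pi g u - u).
have d0 g u : 0 <= d g u by exact: rnorm_ge0.
have gap u A : fixvec A u -> rnorm u <= 12 * (d g0 u + d g1 u + d g2 u).
  move=> /(fixvec_gap noinv g0E g1E g2E); rewrite !rdotvv -!/(d _ _) => h.
  have s0 : 0 <= d g0 u + d g1 u + d g2 u by rewrite !addr_ge0.
  rewrite -(@ler_pXn2r _ 2)// ?nnegrE ?rnorm_ge0// ?mulr_ge0//.
  have := mulr_ge0 (d0 g0 u) (d0 g1 u); have := mulr_ge0 (d0 g0 u) (d0 g2 u).
  by have := mulr_ge0 (d0 g1 u) (d0 g2 u); nra.
have {}gap : rnorm v <= 12 * (d g0 v + d g1 v + d g2 v).
  (* Replacing [v] by [u] costs one distance on the left and 12 * 3 * 2 = 72 on the right. *)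
  apply/ler_addgt0Pr => e e0; have e'0 : 0 < e / 73 by rewrite divr_gt0.
  have [A] := proj_dense c v e'0; set u := proj c A v => uv.
  have uA : fixvec A u by exact: proj_fixvec.
  have du g : d g u <= d g v + 2 * rnorm (v - u).
    have h1 := rnorm_triangle (pi g v) (pi g u) u.
    have h2 := rnorm_triangle v (pi g v) u.
    rewrite -linearB/= rep_rnorm (rnormBC u v) in h1.
    by rewrite /d; lra.
  have h := gap _ _ uA; have := rnorm_triangle u v 0; rewrite !subr0.
  by have := du g0; have := du g1; have := du g2; lra.
rewrite !rdotvv -!/(d _ _).
have s0 : 0 <= d g0 v + d g1 v + d g2 v by rewrite !addr_ge0.
(* Here 432 = 3 * 144, the 3 coming from the square of a sum of three terms. *)
apply: (@le_trans _ _ ((12 * (d g0 v + d g1 v + d g2 v)) ^+ 2)).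
  by rewrite ler_pXn2r ?nnegrE ?rnorm_ge0// mulr_ge0.
have := sqr_ge0 (d g0 v - d g1 v); have := sqr_ge0 (d g0 v - d g2 v).
by have := sqr_ge0 (d g1 v - d g2 v); nra.
Qed.

End spectral_gap.

(** * Weak containment of the trivial representation *)

Section line_map.
Variables (R : realType) (V : hilbertType R) (w : V).

Definition line_map (x : complex_line R) : V := (x : R[i]) *: w.

Let line_map_linear : linear line_map.
Proof. by move=> a x y; rewrite /line_map scalerDl scalerA. Qed.

HB.instance Definition _ := GRing.isLinear.Build R[i] (complex_line R) V _
  line_map line_map_linear.

Lemma hdot_line_map x y : hdot (line_map x) (line_map y) = hdot x y * hdot w w.
Proof. by rewrite /line_map linearZl_LR linearZr_LR/= mulrA. Qed.

End line_map.

Section contains_trivial.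
Variables (R : realType) (G : topologicalGroupType) (pi : unitary_rep R G).

Lemma contains_trivialP : contains_subrep pi (trivial_rep R G) <->
  exists2 u : rep_space pi, u != 0 & forall g, pi g u = u.
Proof.
split=> [[T [Tdot Tg]]|[u u0 ug]].
  exists (T (1 : R[i])); last by move=> g; rewrite -Tg.
  apply/eqP => T0; have := Tdot (1 : R[i]) (1 : R[i]).
  rewrite T0 linear0r => /esym.
  rewrite [LHS]/(complex_dot _ _) /complex_dot rmorph1 mulr1.
  by apply/eqP; rewrite oner_eq0.
pose w := `|u|^-1 *: u.
have ww : hdot w w = 1.
  by rewrite -hdot_norm normrZ normfV normr_id mulVf ?expr1n// normr_eq0.
exists (line_map w); split=> [x y|g x]; first by rewrite hdot_line_map ww mulr1.
by rewrite /line_map linearZ/= /w linearZ/= ug.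
Qed.

End contains_trivial.

(** Weak containment on the finite set [Q] with the identity gives vectors of total squared norm
    near 1 and small total displacement. The gap inequality, summed over these vectors, excludes
    this. *)
Lemma property_T_of_gap (R : realType) (G : topologicalGroupType) (Q : seq G)
    (K : R) :
  (forall (pi : unitary_rep R G), (forall u, (forall g, pi g u = u) -> u = 0) ->
    forall v, rdot v v <= K * \sum_(g <- Q) rdot (pi g v - v) (pi g v - v)) ->
  property_T R G.
Proof.
move=> gap pi wc; apply/contains_trivialP; apply: contrapT => noinv.
have {}noinv u : (forall g, pi g u = u) -> u = 0.
  by move=> ug; have [//|u0] := eqVneq u 0; case: noinv; exists u.
have {}gap := gap pi noinv.
(* With [e = 1 / N] each displacement sum is at most [4 * e], so the gap yields [S <= 1 - 2 * e],
   against [S > 1 - e]. *)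
pose N : R := `|K| * (4 * (size Q)%:R) + 2.
have N2 : 2 <= N by rewrite lerDr !mulr_ge0.
have N0 : 0 < N by lra.
pose e := N^-1; have e0 : 0 < e by rewrite invr_gt0.
have eN : e * N = 1 by rewrite mulVf// gt_eqF.
pose one : complex_line R := (1 : R[i]).
have [|n [eta etaP]] := wc one [set` 1%g :: Q] e _ e0.
  exact/finite_compact/finite_seq.
pose co g : R := \sum_(i < n) rdot (pi g (eta i)) (eta i).
have coP g : g \in 1%g :: Q -> `|1 - co g| < e.
  move=> /etaP; rewrite -ltcR; apply: le_lt_trans.
  apply: le_trans (normc_ge_Re _); rewrite ReD ReN Re_sum.
  have d11 : hdot (trivial_rep R G g one) one = 1.
    by change ((1 : R[i]) * (1 : R[i])^* = 1); rewrite rmorph1 mulr1.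
  by rewrite d11.
pose S := \sum_(i < n) rdot (eta i) (eta i).
have SE : co 1%g = S by apply: eq_bigr => i _; rewrite rep_act1.
have deltaE g : \sum_(i < n) rdot (pi g (eta i) - eta i) (pi g (eta i) - eta i) =
    2 * (S - co g).
  rewrite mulrBr !mulr_sumr -sumrB; apply: eq_bigr => i _.
  rewrite rdotBl !rdotBr {1}/rdot rep_unitary -/(rdot _ _).
  by rewrite (rdotC (eta i) (pi g _)); lra.
have S1 := coP 1%g (mem_head _ _); rewrite SE ltr_norml in S1.
have Sle : S <= K * \sum_(g <- Q) 2 * (S - co g).
  apply: (@le_trans _ _ (\sum_(i < n) K *
    \sum_(g <- Q) rdot (pi g (eta i) - eta i) (pi g (eta i) - eta i))).
    by apply: ler_sum => i _; exact: gap.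
  rewrite -[leLHS]mulr_sumr exchange_big/=.
  by rewrite (eq_bigr _ (fun g _ => deltaE g)).
have sum_le : `|\sum_(g <- Q) 2 * (S - co g)| <= 4 * (size Q)%:R * e.
  rewrite (le_trans (ler_norm_sum _ _ _))//.
  have -> : 4 * (size Q)%:R * e = \sum_(g <- Q) 4 * e.
    by rewrite big_const_seq count_predT iter_addr addr0 -mulr_natr; ring.
  rewrite [leLHS]big_seq [leRHS]big_seq; apply: ler_sum => g gQ.
  have gQ' : g \in 1%g :: Q by rewrite inE gQ orbT.
  have := coP _ gQ'; rewrite ltr_norml => cg.
  by move: S1 cg => /andP[? ?] /andP[? ?]; rewrite ler_norml; apply/andP; split; lra.
have : S <= `|K| * (4 * (size Q)%:R * e).
  rewrite (le_trans Sle)// (le_trans (ler_norm _))// normrM.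
  by rewrite ler_wpM2l.
have -> : `|K| * (4 * (size Q)%:R * e) = 1 - 2 * e.
  by transitivity (e * N - 2 * e); [rewrite /N; ring|rewrite eN].
by move: S1 => /andP[? ?]; lra.
Qed.

Lemma isometry_group_property_T (R : realType) (L : set R) (U : metricType R)
    (m : R) : L `<=` [set x | 0 < x] -> ultrametric_urysohn L U ->
  L m -> (forall x, L x -> x <= m) -> property_T R (isometry_group U).
Proof.
move=> L_pos UU Lm m_max.
have [c [cP c_surj]] := class_map_ex L_pos UU Lm.
have perm_ex := perm_isometry L_pos UU Lm m_max cP c_surj.
have [g0 [g0E _]] := perm_ex _ swap01K.
have [g1 [g1E _]] := perm_ex _ swap12K.
have [g2 [g2E _]] := perm_ex _ swap2K.
apply: (@property_T_of_gap _ _ [:: g0; g1; g2] 432) => pi noinv v.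
rewrite !big_cons big_nil addr0 addrA.
exact: (rep_gap L_pos UU Lm m_max cP v noinv g0E g1E g2E).
Qed.

(** * The Hilbert space l^2 *)

Section unconditional_sums.
Variables (R : realType) (S : choiceType).
Implicit Types (F : S -> R[i]) (A B : {fset S}) (z : R[i]).

Definition cabs z : R := complex.Re `|z|.

Lemma cabsE z : `|z| = (cabs z)%:C%C.
Proof. by rewrite /cabs normc_def. Qed.

Lemma cabs_ge0 z : 0 <= cabs z.
Proof. by rewrite -lecR -cabsE normr_ge0. Qed.

Lemma cabsD z w : cabs (z + w) <= cabs z + cabs w.
Proof. by rewrite -lecR rmorphD/= -!cabsE ler_normD. Qed.

Lemma cabsM z w : cabs (z * w) = cabs z * cabs w.
Proof. by apply: complexI; rewrite rmorphM/= -!cabsE normrM. Qed.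

Lemma cabsN z : cabs (- z) = cabs z.
Proof. by rewrite /cabs normrN. Qed.

Lemma cabs_conj z : cabs z^* = cabs z.
Proof. by rewrite /cabs norm_conjC. Qed.

Lemma cabs_sqr z : z * z^* = (cabs z ^+ 2)%:C%C.
Proof. by rewrite -normCK cabsE rmorphXn. Qed.

Lemma cabs_eq0 z : cabs z = 0 -> z = 0.
Proof. by move=> z0; apply/eqP; rewrite -normr_eq0 cabsE z0. Qed.

(** The index set is not assumed countable, so sums are limits along finite subsets ordered by
    inclusion; they do not depend on an enumeration. *)
Definition fsets_above : set_system {fset S} :=
  filter_from [set: {fset S}] (fun A => [set B | (A `<=` B)%fset]).

Global Instance fsets_above_filter : ProperFilter fsets_above.
Proof.
apply: filter_from_proper; last by move=> A _; exists A; exact: fsubset_refl.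
apply: filter_from_filter; first by exists fset0.
move=> A B _ _; exists (A `|` B)%fset => // C; rewrite /= fsubUset => /andP[].
by split.
Qed.

Definition has_sum F z :=
  (fun B => \sum_(s <- B) F s : R[i]^o) @ fsets_above --> (z : R[i]^o).

Lemma has_sum_unique F z w : has_sum F z -> has_sum F w -> z = w.
Proof. exact: cvg_unique. Qed.

Lemma has_sum_dist F z : has_sum F z <-> forall e : R, 0 < e ->
  exists A, forall B, (A `<=` B)%fset -> cabs (z - \sum_(s <- B) F s) < e.
Proof.
split=> [Fz e e0|Fz].
  have e0C : 0 < e%:C%C by rewrite ltcR.
  have [A _ AB] := (cvgrPdist_lt _ _).1 Fz _ e0C.
  by exists A => B /AB/=; rewrite cabsE ltcR.
apply/cvgrPdist_lt => e e0.
have [r r0 ->] := pos_complexE e0.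
by have [A AB] := Fz r r0; exists A => // B /AB/=; rewrite cabsE ltcR.
Qed.

Lemma has_sumD F F' z w : has_sum F z -> has_sum F' w ->
  has_sum (fun s => F s + F' s) (z + w).
Proof.
move=> /has_sum_dist Fz /has_sum_dist Fw; apply/has_sum_dist => e e0.
have e20 : 0 < e / 2 by rewrite divr_gt0.
have [A Az] := Fz _ e20; have [A' A'w] := Fw _ e20.
exists (A `|` A')%fset => B; rewrite fsubUset => /andP[/Az zB /A'w wB].
rewrite big_split/= opprD addrACA (le_lt_trans (cabsD _ _))//.
by rewrite [ltRHS]splitr ltrD.
Qed.

Lemma has_sumZ a F z : has_sum F z -> has_sum (fun s => a * F s) (a * z).
Proof.
move=> /has_sum_dist Fz; apply/has_sum_dist => e e0.
have a0 : 0 < cabs a + 1 by rewrite ltr_wpDl ?cabs_ge0.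
have [A Az] := Fz (e / (cabs a + 1)) (divr_gt0 e0 a0); exists A => B /Az zB.
rewrite -mulr_sumr -mulrBr cabsM; apply: le_lt_trans (_ : _ <= (cabs a + 1) *
  cabs (z - \sum_(s <- B) F s)) _; first by rewrite ler_wpM2r ?cabs_ge0// lerDl.
by rewrite mulrC -ltr_pdivlMr.
Qed.

Lemma has_sum_conj F z : has_sum F z -> has_sum (fun s => (F s)^*) z^*.
Proof.
move=> /has_sum_dist Fz; apply/has_sum_dist => e /Fz[A AB]; exists A => B /AB.
by rewrite -rmorph_sum -rmorphB cabs_conj.
Qed.

Lemma has_sum_bij F z (f g : S -> S) : cancel f g -> cancel g f ->
  has_sum F z -> has_sum (F \o f) z.
Proof.
move=> fK gK /has_sum_dist Fz; apply/has_sum_dist => e /Fz[A AB].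
exists [fset g s | s in A]%fset => B gAB.
have -> : \sum_(s <- B) (F \o f) s = \sum_(s <- [fset f s | s in B]%fset) F s.
  rewrite -(big_map f xpredT F); apply: perm_big; apply: uniq_perm.
  - by rewrite map_inj_uniq ?fset_uniq//; exact: can_inj fK.
  - exact: fset_uniq.
  - by move=> s; apply/mapP/imfsetP => -[t tB ->]; exists t.
apply: AB; apply/fsubsetP => s sA; apply/imfsetP; exists (g s); last by rewrite gK.
by apply: (fsubsetP gAB); apply/imfsetP; exists s.
Qed.

Lemma sum_fsubset (M : nmodType) (F : S -> M) A B : (A `<=` B)%fset ->
  \sum_(s <- B) F s = \sum_(s <- A) F s + \sum_(s <- (B `\` A)%fset) F s.
Proof.
move=> AB; rewrite (big_fsetID _ (mem A))/=; congr (_ + _).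
  apply: eq_fbigl => s; rewrite !inE/= andbC.
  by case: (boolP (s \in A)) => //= /(fsubsetP AB).
by apply: eq_fbigl => s; rewrite !inE/= andbC.
Qed.

Lemma sum_fsubset_le (f : S -> R) A B : (forall s, 0 <= f s) ->
  (A `<=` B)%fset -> \sum_(s <- A) f s <= \sum_(s <- B) f s.
Proof.
by move=> f0 AB; rewrite (sum_fsubset f AB) lerDl sumr_ge0.
Qed.

Lemma cabs_sum A F : cabs (\sum_(s <- A) F s) <= \sum_(s <- A) cabs (F s).
Proof.
elim/big_rec2: _ => [|s x y _ xy].
  by rewrite -lecR -cabsE normr0.
by rewrite (le_trans (cabsD _ _))// lerD2l.
Qed.

Lemma has_sum_ex F (M : R) :
  (forall A, \sum_(s <- A) cabs (F s) <= M) -> exists z, has_sum F z.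
Proof.
move=> FM; pose P := [set \sum_(s <- A) cabs (F s) | A in [set: {fset S}]].
have Psup : has_sup P.
  split; first by exists (\sum_(s <- fset0) cabs (F s)), fset0.
  by exists M => _ [A _ <-].
suff /complex_complete/cvg_ex[z zP] :
    cauchy ((fun B => \sum_(s <- B) F s : R[i]^o) @ fsets_above).
  by exists z.
apply/cauchy_ballP => e e0.
have [r r0 ->] := pos_complexE e0.
have r20 : 0 < r / 2 by rewrite divr_gt0.
(* A finite set whose absolute sum nearly attains the supremum leaves less than [r / 2] outside
   it. *)
have [_ [A _ <-] Ar] := sup_adherent r20 Psup.
have tail B : (A `<=` B)%fset ->
    cabs (\sum_(s <- B) F s - \sum_(s <- A) F s) < r / 2.
  move=> AB; rewrite (sum_fsubset F AB) addrC addKr.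
  have : \sum_(s <- B) cabs (F s) <= sup P.
    by apply: sup_ubound; [case: Psup|exists B].
  have := cabs_sum (B `\` A)%fset F.
  by rewrite (sum_fsubset (cabs \o F) AB)/=; lra.
pose T := [set w : R[i]^o | cabs (w - \sum_(s <- A) F s) < r / 2].
exists (T, T) => /=; first by split; exists A => // B /tail.
move=> [x y] /= [xT yT]; rewrite -ball_normE/= cabsE ltcR.
have -> : x - y = (x - \sum_(s <- A) F s) - (y - \sum_(s <- A) F s) by ring.
by rewrite (le_lt_trans (cabsD _ _))// cabsN [ltRHS]splitr ltrD.
Qed.

End unconditional_sums.

Section ell2_space.
Variables (R : realType) (S : choiceType).

Definition square_summable (f : S -> R[i]^o) := exists M : R,
  forall A : {fset S}, \sum_(s <- A) cabs (f s) ^+ 2 <= M.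

Definition ell2_pred : {pred (S -> R[i]^o)} :=
  [pred f | `[< square_summable f >]].

Lemma cabsD_sqr (z w : R[i]) :
  cabs (z + w) ^+ 2 <= 2 * cabs z ^+ 2 + 2 * cabs w ^+ 2.
Proof.
have := cabsD z w; have := cabs_ge0 (z + w).
have := cabs_ge0 z; have := cabs_ge0 w => w0 z0 zw0 zw.
apply: (@le_trans _ _ ((cabs z + cabs w) ^+ 2)).
  by rewrite ler_pXn2r ?nnegrE ?addr_ge0.
have := sqr_ge0 (cabs z - cabs w); nra.
Qed.

Lemma ell2_submod : submod_closed ell2_pred.
Proof.
split=> [|a f g]; rewrite !inE.
  exists 0 => A; rewrite big1// => s _.
  by rewrite [X in cabs X](_ : _ = 0)// /cabs normr0 expr0n.
move=> [M fM] [N gN].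
exists (2 * (cabs a ^+ 2 * M) + 2 * N) => A.
apply: (@le_trans _ _ (\sum_(s <- A) (2 * (cabs a ^+ 2 * cabs (f s) ^+ 2)
   + 2 * cabs (g s) ^+ 2))).
  by apply: ler_sum => s _; rewrite -exprMn -cabsM; exact: cabsD_sqr.
rewrite big_split/= -!mulr_sumr lerD// ler_pM2l//.
by rewrite ler_wpM2l// exprn_ge0// cabs_ge0.
Qed.

HB.instance Definition _ :=
  GRing.isSubmodClosed.Build R[i] (S -> R[i]^o) ell2_pred ell2_submod.

Record ell2 := Ell2 { ell2_fun :> S -> R[i]^o ; ell2_funP : ell2_fun \in ell2_pred }.

HB.instance Definition _ := [isSub for ell2_fun].
HB.instance Definition _ := [Choice of ell2 by <:].
HB.instance Definition _ := [SubChoice_isSubLmodule of ell2 by <:].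

Implicit Types (f g h : ell2) (z : R[i]).

Lemma ell2DE f g s : (f + g) s = f s + g s.
Proof. by []. Qed.

Lemma ell2BE f g s : (f - g) s = f s - g s.
Proof. by []. Qed.

Lemma ell2ZE z f s : (z *: f) s = z * f s.
Proof. by []. Qed.

Lemma ell2_eqP f g : f =1 g -> f = g.
Proof. by move=> fg; apply/val_inj/funext. Qed.

Lemma ell2_bounded f : square_summable f.
Proof. by have := ell2_funP f; rewrite inE. Qed.

Lemma ell2_dot_ex f g : exists z, has_sum (fun s => f s * (g s)^*) z.
Proof.
have [M fM] := ell2_bounded f; have [N gN] := ell2_bounded g.
apply: (@has_sum_ex _ _ _ (M + N)) => A.
apply: (@le_trans _ _ (\sum_(s <- A) (cabs (f s) ^+ 2 + cabs (g s) ^+ 2))).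
  apply: ler_sum => s _; rewrite cabsM cabs_conj.
  have := sqr_ge0 (cabs (f s) - cabs (g s)).
  have := sqr_ge0 (cabs (f s) + cabs (g s)); nra.
by rewrite big_split lerD.
Qed.

Definition ell2_dot f g : R[i] := sval (cid (ell2_dot_ex f g)).

Lemma ell2_dotP f g : has_sum (fun s => f s * (g s)^*) (ell2_dot f g).
Proof. by rewrite /ell2_dot; case: cid. Qed.

Arguments ell2_dotP : clear implicits.

Lemma ell2_dotE f g z : has_sum (fun s => f s * (g s)^*) z -> ell2_dot f g = z.
Proof. exact: has_sum_unique (ell2_dotP f g). Qed.

Let ell2_dot_bilinear :
  bilinear_for ( *%R ) (@Num.conj R[i] \; *%R) ell2_dot.
Proof.
split=> [h a f g|h a f g] /=; apply: ell2_dotE.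
  have := has_sumD (has_sumZ (a := a) (ell2_dotP f h)) (ell2_dotP g h).
  by congr has_sum; apply/funext => s; rewrite ell2DE ell2ZE mulrDl mulrA.
have := has_sumD (has_sumZ (a := a^*) (ell2_dotP h f)) (ell2_dotP h g).
congr has_sum; apply/funext => s.
by rewrite ell2DE ell2ZE rmorphD rmorphM mulrDr mulrCA.
Qed.

HB.instance Definition _ :=
  bilinear_isBilinear.Build R[i] ell2 ell2 R[i] ( *%R ) (@Num.conj R[i] \; *%R)
    ell2_dot ell2_dot_bilinear.

Let ell2_dot_hermitian f g :
  ell2_dot f g = (-1) ^+ false * (ell2_dot g f)^*.
Proof.
rewrite expr0 mul1r; apply: ell2_dotE.
have := has_sum_conj (ell2_dotP g f).
by congr has_sum; apply/funext => s; rewrite rmorphM/= conjCK mulrC.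
Qed.

HB.instance Definition _ :=
  isHermitianSesquilinear.Build R[i] ell2 false (@Num.conj R[i]) ell2_dot
    ell2_dot_hermitian.

Definition ell2_norm2 f : R := complex.Re (ell2_dot f f).

Lemma ell2_sum_sqr f (A : {fset S}) :
  \sum_(s <- A) f s * (f s)^* = (\sum_(s <- A) cabs (f s) ^+ 2)%:C%C.
Proof. by rewrite rmorph_sum; apply: eq_bigr => s _; exact: cabs_sqr. Qed.

Lemma ell2_norm2P f (e : R) : 0 < e -> exists A, forall B, (A `<=` B)%fset ->
  `|ell2_norm2 f - \sum_(s <- B) cabs (f s) ^+ 2| < e.
Proof.
move=> e0; have [A AB] := (has_sum_dist _ _).1 (ell2_dotP f f) e e0.
exists A => B /AB; rewrite ell2_sum_sqr; apply: le_lt_trans.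
rewrite -lecR -cabsE; apply: le_trans (normc_ge_Re _).
by rewrite lecR /ell2_norm2; case: (ell2_dot f f).
Qed.

Lemma ell2_norm2_ge f (A : {fset S}) :
  \sum_(s <- A) cabs (f s) ^+ 2 <= ell2_norm2 f.
Proof.
apply/ler_addgt0Pr => e /(ell2_norm2P f)[B].
move=> /(_ (A `|` B)%fset (fsubsetUr _ _)); rewrite ltr_norml => /andP[h _].
have sq0 s : 0 <= cabs (f s) ^+ 2 by exact: sqr_ge0.
by have := sum_fsubset_le sq0 (fsubsetUl A B); lra.
Qed.

Lemma ell2_norm2_le f (M : R) :
  (forall A : {fset S}, \sum_(s <- A) cabs (f s) ^+ 2 <= M) -> ell2_norm2 f <= M.
Proof.
move=> fM; apply/ler_addgt0Pr => e /(ell2_norm2P f)[B].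
move=> /(_ B (fsubset_refl _)); rewrite ltr_norml => /andP[_ h].
by have := fM B; lra.
Qed.

Lemma ell2_norm2_ge0 f : 0 <= ell2_norm2 f.
Proof. by have := ell2_norm2_ge f fset0; rewrite big_seq_fset0. Qed.

Lemma ell2_dotvv f : ell2_dot f f = (ell2_norm2 f)%:C%C.
Proof.
have := ell2_dot_hermitian f f; rewrite expr0 mul1r /ell2_norm2.
case: (ell2_dot f f) => a b.
change (Complex a b = Complex a (- b) -> Complex a b = Complex a 0).
by case=> bN; congr Complex; lra.
Qed.

Lemma ell2_cabs_le f s : cabs (f s) ^+ 2 <= ell2_norm2 f.
Proof. by have := ell2_norm2_ge f [fset s]%fset; rewrite big_seq_fset1. Qed.

Lemma ell2_norm2_eq0 f : ell2_norm2 f = 0 -> f = 0.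
Proof.
move=> f0; apply: ell2_eqP => s; apply: cabs_eq0.
have := ell2_cabs_le f s; have := cabs_ge0 (f s); rewrite f0.
by move=> c0 c2; nra.
Qed.

Let ell2_dot_gt0 f : f != 0 -> 0 < ell2_dot f f.
Proof.
move=> f0; rewrite ell2_dotvv ltcR lt_neqAle ell2_norm2_ge0 andbT eq_sym.
by apply: contra f0 => /eqP/ell2_norm2_eq0 ->.
Qed.

HB.instance Definition _ := isDotProduct.Build R[i] ell2 ell2_dot ell2_dot_gt0.

Definition ell2_rnorm f : R := Num.sqrt (ell2_norm2 f).

Lemma ell2_rnorm_sqr f : ell2_rnorm f ^+ 2 = ell2_norm2 f.
Proof. by rewrite sqr_sqrtr// ell2_norm2_ge0. Qed.

Lemma ell2_norm2Z z f : ell2_norm2 (z *: f) = cabs z ^+ 2 * ell2_norm2 f.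
Proof.
apply: complexI; rewrite -ell2_dotvv linearZl_LR linearZr_LR/= mulrA cabs_sqr.
by rewrite ell2_dotvv [RHS]rmorphM.
Qed.

Lemma ell2_rnormZ z f : ell2_rnorm (z *: f) = cabs z * ell2_rnorm f.
Proof.
by rewrite /ell2_rnorm ell2_norm2Z sqrtrM ?sqr_ge0// sqrtr_sqr ger0_norm ?cabs_ge0.
Qed.

Lemma ell2_norm2D f g : ell2_norm2 (f + g) =
  ell2_norm2 f + ell2_norm2 g + 2 * complex.Re (ell2_dot f g).
Proof.
rewrite {1}/ell2_norm2 linearDl/= !linearDr/=.
rewrite [ell2_dot g f]ell2_dot_hermitian expr0 mul1r.
rewrite !ell2_dotvv; set d := ell2_dot f g.
have -> : Num.conj d = conjc d by [].
by case: d => a b /=; ring.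
Qed.

Lemma ell2_rnormD f g : ell2_rnorm (f + g) <= ell2_rnorm f + ell2_rnorm g.
Proof.
set a := ell2_rnorm f; set b := ell2_rnorm g.
have a0 : 0 <= a by exact: sqrtr_ge0.
have b0 : 0 <= b by exact: sqrtr_ge0.
rewrite -(@ler_pXn2r _ 2)// ?nnegrE ?addr_ge0 ?sqrtr_ge0//.
rewrite ell2_rnorm_sqr ell2_norm2D -!ell2_rnorm_sqr -/a -/b.
suff : complex.Re (ell2_dot f g) <= a * b by nra.
have [f0|/eqP f0] := eqVneq (ell2_norm2 f) 0.
  by rewrite (ell2_norm2_eq0 f0) linear0l mulr_ge0.
have [g0|/eqP g0] := eqVneq (ell2_norm2 g) 0.
  by rewrite (ell2_norm2_eq0 g0) linear0r mulr_ge0.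
have pos h : ell2_norm2 h <> 0 -> 0 < ell2_rnorm h.
  move=> h0; rewrite sqrtr_gt0 lt_neqAle ell2_norm2_ge0 andbT eq_sym.
  exact/eqP.
have ap : 0 < a by exact: pos.
have bp : 0 < b by exact: pos.
(* Cauchy-Schwarz: the squared norm of this combination is [2 * a * b] times the difference of
   [a * b] and the real part of the product. *)
have := ell2_norm2_ge0 (b%:C%C *: f + (- a%:C%C) *: g).
rewrite ell2_norm2D !ell2_norm2Z cabsN.
have cR (x : R) : 0 <= x -> cabs x%:C%C = x.
  by move=> x0; apply: complexI; rewrite -cabsE ger0_norm// lecR.
rewrite !cR// -!ell2_rnorm_sqr -/a -/b.
have -> : ell2_dot (b%:C%C *: f) (- a%:C%C *: g) =
    b%:C%C * (conjc (- a%:C%C) * ell2_dot f g).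
  by rewrite linearZl_LR linearZr_LR.
have -> (d : R[i]) : complex.Re (b%:C%C * (conjc (- a%:C%C) * d)) =
    - (a * b * complex.Re d) by case: d => x y /=; ring.
move=> h; have ab : 0 < a * b by rewrite mulr_gt0.
rewrite -(ler_pM2l ab); nra.
Qed.

Lemma ell2_rnorm_eq0 f : ell2_rnorm f = 0 -> f = 0.
Proof.
by move=> f0; apply: ell2_norm2_eq0; rewrite -ell2_rnorm_sqr f0 expr0n.
Qed.

Let nrm f : R[i] := (ell2_rnorm f)%:C%C.

Let nrmD f g : nrm (f + g) <= nrm f + nrm g.
Proof. by rewrite /nrm -rmorphD lecR ell2_rnormD. Qed.

Let nrmZ z f : nrm (z *: f) = `|z| * nrm f.
Proof. by rewrite /nrm ell2_rnormZ rmorphM /= cabsE. Qed.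

Let nrm0 f : nrm f = 0 -> f = 0.
Proof. by move=> /complexI/ell2_rnorm_eq0. Qed.

HB.instance Definition _ :=
  Lmodule_isNormed.Build R[i] ell2 nrmD nrmZ nrm0.

Lemma ell2_normE f : `|f| = (ell2_rnorm f)%:C%C.
Proof. by []. Qed.

End ell2_space.

Arguments ell2_dotP {R S} f g.

Section ell2_complete.
Variables (R : realType) (S : choiceType).
Local Notation H := (ell2 R S).

Lemma ell2_ballE (f : H) (e : R) : ball f e%:C%C = [set g | ell2_rnorm (f - g) < e].
Proof.
by apply/seteqP; split=> g; rewrite -ball_normE/= ell2_normE ltcR.
Qed.

Lemma ell2_complete (F : set_system H) :
  ProperFilter F -> cauchy F -> cvg F.
Proof.
move=> FF /cauchy_ballP Fc.
have coord s : exists z : R[i]^o, (fun f : H => f s) @ F --> z.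
  apply/cvg_ex; apply: complex_complete; apply/cauchy_ballP => e e0.
  have [[P Q] /= [FP FQ] PQ] := Fc _ e0.
  exists ([set f s | f in P], [set f s | f in Q]) => /=.
    by split; [apply: filterS FP|apply: filterS FQ] => f Pf /=; exists f.
  move=> [_ _] /= [[f Pf <-] [g Qg <-]].
  have [r r0 er] := pos_complexE e0.
  have := PQ (f, g) (conj Pf Qg); rewrite /= er ell2_ballE/= => fg.
  rewrite -ball_normE/= cabsE ltcR -(ell2BE f g); apply: le_lt_trans fg.
  rewrite -(@ler_pXn2r _ 2)// ?nnegrE ?cabs_ge0 ?sqrtr_ge0//.
  by rewrite ell2_rnorm_sqr ell2_cabs_le.
have [phi phiP] := choice coord.
have near_phi (s : S) (e : R) : 0 < e -> F [set g : H | cabs (g s - phi s) < e].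
  move=> e0; have e0C : 0 < e%:C%C by rewrite ltcR.
  have : F [set g : H | ball (phi s) e%:C%C (g s)].
    by apply: phiP; exact: nbhsx_ballx.
  by apply: filterS => g; rewrite /= -ball_normE/= distrC cabsE ltcR.
have near_sum (r : seq S) (e : R) : 0 < e ->
    F [set g : H | \sum_(s <- r) cabs (g s - phi s) ^+ 2 < e].
  elim: r e => [|s r IH] e e0.
    by apply: filterS filterT => g _; rewrite /= big_nil.
  have e20 : 0 < e / 2 by rewrite divr_gt0.
  have q0 : 0 < Num.sqrt (e / 2) by rewrite sqrtr_gt0.
  apply: filterS (filterI (near_phi s _ q0) (IH _ e20)) => g [gs gr] /=.
  rewrite big_cons [ltRHS]splitr ltrD// -[ltRHS]sqr_sqrtr ?ltW//.
  by rewrite ltr_pXn2r ?nnegrE ?cabs_ge0 ?sqrtr_ge0.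
(* For each finite [A] a vector [g] is inserted that is close to [f] in norm and to [phi] on [A]. It
   depends on [A], but the bound does not. *)
have close (e : R) : 0 < e -> exists2 P : set H, F P & forall f, P f ->
    forall A : {fset S}, \sum_(s <- A) cabs (f s - phi s) ^+ 2 <= 4 * e ^+ 2.
  move=> e0; have e0C : 0 < e%:C%C by rewrite ltcR.
  have [[P Q] /= [FP FQ] PQ] := Fc _ e0C; exists P => // f Pf A.
  have e20 : 0 < e ^+ 2 by rewrite exprn_gt0.
  have [g [Qg gA]] := filter_ex (filterI FQ (near_sum A _ e20)).
  have := PQ (f, g) (conj Pf Qg); rewrite /= ell2_ballE/= => fg.
  have {}fg : ell2_norm2 (f - g) < e ^+ 2.
    by rewrite -ell2_rnorm_sqr ltr_pXn2r ?nnegrE ?sqrtr_ge0 ?ltW.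
  have := ell2_norm2_ge (f - g) A.
  have : \sum_(s <- A) cabs (f s - phi s) ^+ 2 <=
      2 * (\sum_(s <- A) cabs ((f - g) s) ^+ 2) +
      2 * (\sum_(s <- A) cabs (g s - phi s) ^+ 2).
    rewrite !mulr_sumr -big_split/=; apply: ler_sum => s _.
    by rewrite -(subrKA (g s)); exact: cabsD_sqr.
  by move: gA => /=; lra.
have phi2 : phi \in @ell2_pred R S.
  have [P FP Pphi] := close 1 ltr01.
  have [f Pf] := filter_ex FP; have [M fM] := ell2_bounded f.
  rewrite inE; exists (2 * M + 2 * (4 * 1 ^+ 2)) => A.
  apply: (@le_trans _ _ (\sum_(s <- A)
    (2 * cabs (f s) ^+ 2 + 2 * cabs (f s - phi s) ^+ 2))).
    apply: ler_sum => s _; rewrite -[X in cabs X ^+ 2 <= _](subKr (f s)).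
    by have := cabsD_sqr (f s) (- (f s - phi s)); rewrite cabsN.
  by rewrite big_split/= -!mulr_sumr lerD// ler_wpM2l// Pphi.
apply/cvg_ex; exists (Ell2 phi2); apply/cvg_ballP => e /pos_complexE[r r0 ->].
(* The bound of [close] is then a quarter of [r ^+ 2]. *)
have r40 : 0 < r / 4 by rewrite divr_gt0.
have [P FP Pphi] := close _ r40; apply: filterS FP => f Pf /=.
apply: ball_sym; rewrite ell2_ballE/=.
rewrite -(@ltr_pXn2r _ 2)// ?nnegrE ?sqrtr_ge0 ?ltW// ell2_rnorm_sqr.
have : ell2_norm2 (f - Ell2 phi2) <= 4 * (r / 4) ^+ 2.
  by apply: ell2_norm2_le => A; exact: Pphi.
by move=> /le_lt_trans; apply; have := mulr_gt0 r0 r0; lra.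
Qed.

HB.instance Definition _ := Uniform_isComplete.Build H ell2_complete.

Let ell2_dot_norm (f : H) : `|f| ^+ 2 = ell2_dot f f.
Proof. by rewrite ell2_normE ell2_dotvv -ell2_rnorm_sqr [RHS]rmorphXn. Qed.

HB.instance Definition _ := isHilbert.Build R H ell2_dot_norm.

Definition ell2_hilbert : hilbertType R := H.

End ell2_complete.

(** * Permutation representations *)

Section permutation_representation.
Variables (R : realType) (G : topologicalGroupType) (S : choiceType).
Variable act : G -> S -> S.
Hypotheses (act1 : forall s, act 1%g s = s)
  (actM : forall g h s, act (g * h)%g s = act g (act h s))
  (act_open : forall (g0 : G) s, \forall g \near g0, act g s = act g0 s).
Local Notation H := (ell2_hilbert R S).
Local Notation E := (ell2 R S).

Lemma actK g : cancel (act g) (act g^-1%g).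
Proof. by move=> s; rewrite -actM mulVg act1. Qed.

Lemma actVK g : cancel (act g^-1%g) (act g).
Proof. by move=> s; rewrite -actM mulgV act1. Qed.

Lemma translate_subproof g (f : E) : f \o act g^-1%g \in @ell2_pred R S.
Proof.
rewrite inE; exists (ell2_norm2 f) => A.
have -> : \sum_(s <- A) cabs ((f \o act g^-1%g) s) ^+ 2 =
    \sum_(s <- [fset act g^-1%g s | s in A]%fset) cabs (f s) ^+ 2.
  rewrite -(big_map (act g^-1%g) xpredT (fun s => cabs (f s) ^+ 2)).
  apply: perm_big; apply: uniq_perm.
  - by rewrite map_inj_uniq ?fset_uniq//; exact: can_inj (actVK g).
  - exact: fset_uniq.
  - by move=> s; apply/mapP/imfsetP => -[t tA ->]; exists t.
exact: ell2_norm2_ge.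
Qed.

Definition translate g (f : E) : E := Ell2 (translate_subproof g f).

Lemma translateE g f s : translate g f s = f (act g^-1%g s).
Proof. by []. Qed.

Let translate_linear g : linear (translate g : H -> H).
Proof. by move=> a f h; apply: ell2_eqP => s. Qed.

HB.instance Definition _ g :=
  GRing.isLinear.Build R[i] H H _ (translate g) (translate_linear g).

Lemma translate1 f : translate 1%g f = f.
Proof.
apply: ell2_eqP => s; rewrite translateE; congr (f _).
by rewrite -{1}[s]act1 actK.
Qed.

Lemma translateM g h f : translate (g * h)%g f = translate g (translate h f).
Proof. by apply: ell2_eqP => s; rewrite !translateE invgM actM. Qed.

Lemma translate_dot g (f h : E) :
  ell2_dot (translate g f) (translate g h) = ell2_dot f h.
Proof.
apply: ell2_dotE; have := ell2_dotP f h.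
exact: (has_sum_bij (actVK g) (actK g)).
Qed.

Definition trunc_fun (A : {fset S}) (f : E) s : R[i]^o :=
  if s \in A then f s else 0.

Lemma trunc_subproof A f : trunc_fun A f \in @ell2_pred R S.
Proof.
rewrite inE; have [M fM] := ell2_bounded f; exists M => B.
apply: le_trans (fM B); apply: ler_sum => s _; rewrite /trunc_fun.
by case: ifP => // _; rewrite {1}/cabs normr0 expr0n/= sqr_ge0.
Qed.

Definition trunc A f : E := Ell2 (trunc_subproof A f).

Lemma trunc_close (f : E) (e : R) : 0 < e ->
  exists A, ell2_norm2 (f - trunc A f) <= e.
Proof.
move=> e0; have [A AB] := ell2_norm2P f e0; exists A.
have := AB A (fsubset_refl A); rewrite ltr_norml => /andP[_ fA].
apply: ell2_norm2_le => B.
have := ell2_norm2_ge f (A `|` B)%fset.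
rewrite (sum_fsubset _ (fsubsetUl A B)) => h.
set T := \sum_(s <- _) _; suff : T <= \sum_(s <- ((A `|` B) `\` A)%fset) cabs (f s) ^+ 2.
  by lra.
rewrite {}/T (bigID (fun s => s \in A)) big1 => [|s]; last first.
  move=> /andP[_ sA].
  by rewrite ell2BE [trunc A f s]/(trunc_fun A f s) /trunc_fun sA subrr /cabs normr0 expr0n.
rewrite Monoid.mul1m -big_filter.
rewrite [leLHS](_ : _ = \sum_(s <- [seq s <- B | s \notin A]) cabs (f s) ^+ 2).
  rewrite [leLHS](_ : _ = \sum_(s <- ((A `|` B) `\` A)%fset) cabs (f s) ^+ 2)//.
  apply: perm_big; apply: uniq_perm; [exact: filter_uniq|exact: fset_uniq|].
  by move=> s; rewrite mem_filter !inE; case: (s \in A).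
apply: eq_big_seq => s.
rewrite mem_filter ell2BE [trunc A f s]/(trunc_fun A f s) /trunc_fun.
by move=> /andP[/negbTE -> _]; rewrite subr0.
Qed.

Lemma translate_trunc A f g g0 : (forall s, s \in A -> act g s = act g0 s) ->
  translate g (trunc A f) = translate g0 (trunc A f).
Proof.
move=> gg0; apply: ell2_eqP => s; rewrite !translateE /= /trunc_fun.
have gV : act g^-1%g s \in A -> act g0^-1%g s = act g^-1%g s.
  by move=> /gg0; rewrite actVK => {1}->; rewrite actK.
have g0V : act g0^-1%g s \in A -> act g^-1%g s = act g0^-1%g s.
  by move=> /gg0; rewrite actVK => {1}<-; rewrite actK.
case: ifPn => [gA|gA]; first by rewrite (gV gA) gA.
by case: ifPn => // g0A; move: gA; rewrite (g0V g0A) g0A.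
Qed.

Lemma translate_rnorm g f : ell2_rnorm (translate g f) = ell2_rnorm f.
Proof. by rewrite /ell2_rnorm /ell2_norm2 translate_dot. Qed.

(** On a finitely supported vector the translation is locally constant in [g], by [act_open];
    truncation approximates [f] by such vectors, uniformly in [g]. *)
Lemma translate_continuous (f : H) : continuous (fun g : G => translate g f : H).
Proof.
move=> g0; apply/cvg_ballP => e /pos_complexE[r r0 ->].
have r40 : 0 < (r / 4) ^+ 2 by rewrite exprn_gt0// divr_gt0.
have [A fA] := trunc_close f r40.
have near_A : \forall g \near g0, forall s, s \in A -> act g s = act g0 s.
  have : \forall g \near g0, forall s, s \in (A : seq S) -> act g s = act g0 s.
    elim: (A : seq S) => [|s B IH]; first by near=> g => s; rewrite in_nil.
    near=> g => t; rewrite inE => /predU1P[->|]; first by near: g; exact: act_open.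
    by move: t; near: g.
  by [].
near=> g.
have gA : forall s, s \in A -> act g s = act g0 s by near: g.
rewrite /= ell2_ballE/=.
pose d := f - trunc A f.
have small : ell2_rnorm d <= r / 4.
  have r4 : 0 <= r / 4 by rewrite divr_ge0// ltW.
  by rewrite -(@ler_pXn2r _ 2)// ?nnegrE ?sqrtr_ge0// ell2_rnorm_sqr.
have -> : translate g0 f - translate g f = translate g0 d - translate g d.
  rewrite /d !(linearB (translate _ : {linear H -> H}))/= (translate_trunc f gA).
  by rewrite opprB addrA subrK.
have -> : translate g0 d - translate g d = translate g0 d + (-1) *: translate g d.
  by rewrite scaleN1r.
rewrite (le_lt_trans (ell2_rnormD _ _))// ell2_rnormZ cabsN.
have -> : cabs (1 : R[i]) = 1 by rewrite /cabs normr1.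
by rewrite mul1r !translate_rnorm; lra.
Unshelve. all: by end_near. Qed.

Definition permutation_rep : unitary_rep R G :=
  @UnitaryRep R G H (fun g => translate g : {linear H -> H})
    translate1 translateM translate_dot translate_continuous.

Lemma delta_subproof (s : S) : (fun t => (t == s)%:R : R[i]^o) \in @ell2_pred R S.
Proof.
rewrite inE; exists 1 => A.
have [sA|sA] := boolP (s \in A).
  rewrite (bigD1_seq s) ?fset_uniq//= eqxx big1 => [|t /negbTE ->].
    by rewrite addr0 /cabs normr1 expr1n.
  by rewrite /cabs normr0 expr0n.
rewrite big_seq big1 ?ler01// => t tA.
have /negbTE -> : t != s by apply: contraNneq sA => <-.
by rewrite /cabs normr0 expr0n.
Qed.

Definition delta (s : S) : E := Ell2 (delta_subproof s).

Lemma delta_norm2 s : ell2_norm2 (delta s) = 1.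
Proof.
apply/eqP; rewrite eq_le; apply/andP; split; last first.
  have := ell2_cabs_le (delta s) s.
  by rewrite /= eqxx {1}/cabs normr1 expr1n.
apply: ell2_norm2_le => A; have [sA|sA] := boolP (s \in A).
  rewrite (bigD1_seq s) ?fset_uniq//= eqxx big1 => [|t /negbTE ->].
    by rewrite addr0 /cabs normr1 expr1n.
  by rewrite /cabs normr0 expr0n.
rewrite big_seq big1 ?ler01// => t tA.
have /negbTE /= -> : t != s by apply: contraNneq sA => <-.
by rewrite /cabs normr0 expr0n.
Qed.

Lemma translate_delta g s : act g s = s -> translate g (delta s) = delta s.
Proof.
move=> gs; apply: ell2_eqP => t; rewrite translateE /=; congr (_%:R).
by rewrite (can2_eq (actVK g) (actK g)) gs.
Qed.

(** At a point fixed by [Q] the coefficient of a multiple of [delta s] equals the trivial one on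
    [Q]. An invariant vector is constant on orbits, so on infinite orbits square summability makes
    it zero. *)
Lemma permutation_not_T :
  (forall s, exists g : nat -> G, injective (fun n => act (g n) s)) ->
  (forall Q : set G, compact Q -> exists s, forall g, Q g -> act g s = s) ->
  ~ property_T R G.
Proof.
move=> orb_inf cpt_fix /(_ permutation_rep) T.
have /contains_trivialP[v /eqP v0 vinv] : contains_subrep permutation_rep (trivial_rep R G).
  apply: T => xi Q e Qc e0; have [s sQ] := cpt_fix Q Qc.
  exists 1%N, (fun=> (xi : R[i]) *: (delta s : H)) => g /sQ gs.
  rewrite big_ord1 [X in `|X|](_ : _ = 0) ?normr0 ?ltcR//.
  have -> : permutation_rep g ((xi : R[i]) *: (delta s : H)) =
      (xi : R[i]) *: (delta s : H).
    by rewrite linearZ; congr (_ *: _); exact: translate_delta.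
  rewrite linearZl_LR linearZr_LR/=.
  have -> : hdot (delta s : H) (delta s) = 1.
    by rewrite [LHS](ell2_dotvv (delta s)) delta_norm2.
  by rewrite mulr1; exact: subrr.
apply: v0; apply: ell2_eqP => s.
have [g ginj] := orb_inf s.
have vg n : (v : E) (act (g n) s) = (v : E) s.
  have := congr1 (fun w : E => w (act (g n) s)) (vinv (g n)).
  by rewrite /= actK.
apply: cabs_eq0; apply/eqP; apply: contraT => vs0.
have vs : 0 < cabs ((v : E) s) ^+ 2 by rewrite exprn_gt0// lt_neqAle eq_sym vs0 cabs_ge0.
(* So many points of the orbit already exceed the squared norm of [v]. *)
pose n := (Num.truncn (ell2_norm2 v / cabs ((v : E) s) ^+ 2)).+1.
have := ell2_norm2_ge v [fset act (g k) s | k in iota 0 n]%fset.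
have -> : \sum_(t <- [fset act (g k) s | k in iota 0 n]%fset) cabs ((v : E) t) ^+ 2 =
    \sum_(k <- iota 0 n) cabs ((v : E) (act (g k) s)) ^+ 2.
  rewrite -(big_map (fun k => act (g k) s) xpredT (fun t => cabs ((v : E) t) ^+ 2)).
  apply: perm_big; apply: uniq_perm; first exact: fset_uniq.
    by rewrite map_inj_uniq ?iota_uniq.
  by move=> t; apply/imfsetP/mapP => -[k kn ->]; exists k.
under eq_bigr do rewrite vg.
rewrite big_const_seq count_predT size_iota iter_addr addr0 -mulr_natl -ler_pdivlMr//.
by rewrite leNgt truncnS_gt.
Qed.

End permutation_representation.

(** * The action on balls when there is no maximal distance *)

Section balls.
Variables (R : realType) (L : set R) (U : metricType R).
Hypotheses (L_pos : L `<=` [set x | 0 < x]) (UU : ultrametric_urysohn L U).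
Local Notation G := (isometry_group U).

Definition closed_ball_at (x : U) (l : R) : set U := [set y | mdist x y <= l].

Lemma closed_ball_at_eq x y l : mdist x y <= l ->
  closed_ball_at x l = closed_ball_at y l.
Proof.
move=> xy; apply/seteqP; split=> z /= zl;
  apply: le_trans (urysohn_ultra UU _ _ _) _; rewrite ge_max; apply/andP.
  by split; [rewrite metric_sym; exact: xy|exact: zl].
by split; [exact: xy|exact: zl].
Qed.

Lemma closed_ball_at_image (g : G) x l :
  g @` closed_ball_at x l = closed_ball_at (g x) l.
Proof.
apply/seteqP; split=> [_ [y xy <-]|y gxy].
  by rewrite /closed_ball_at/= isometry_isometric.
exists (g^-1%g y); last exact: isometry_invKV.
rewrite /closed_ball_at/= -(isometry_isometric g) [X in mdist _ X]isometry_invKV.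
exact: gxy.
Qed.

(** Only the set is kept: each point of a ball is a center of it, so recording a center would split
    one ball into many. *)
Record ballset := Ballset {
  ball_set :> set U;
  ball_setP : exists x l, L l /\ ball_set = closed_ball_at x l
}.

HB.instance Definition _ := gen_eqMixin ballset.
HB.instance Definition _ := gen_choiceMixin ballset.

Lemma ballset_eq (b b' : ballset) : b = b' :> set U -> b = b'.
Proof.
case: b b' => [b bP] [b' b'P] /= bb'; subst b'.
by rewrite (Prop_irrelevance bP b'P).
Qed.

Lemma ball_image_subproof (g : G) (b : ballset) :
  exists x l, L l /\ g @` b = closed_ball_at x l.
Proof.
have [x [l [Ll ->]]] := ball_setP b; exists (g x), l; split=> //.
exact: closed_ball_at_image.
Qed.

Definition ball_act (g : G) (b : ballset) : ballset :=
  Ballset (ball_image_subproof g b).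

Lemma ball_act1 b : ball_act 1%g b = b.
Proof. by apply: ballset_eq; exact: image_id. Qed.

Lemma ball_actM g h b : ball_act (g * h)%g b = ball_act g (ball_act h b).
Proof. by apply: ballset_eq; rewrite /= image_comp. Qed.

Lemma near_isometry (g0 : G) (x : U) (e : R) : 0 < e ->
  \forall g \near g0, mdist (g0 x) ((g : G) x) < e.
Proof.
move=> e0; have FF := nbhs_filter g0.
have h : (g : G) x @[g --> g0] --> g0 x.
  exact: (isometry_cvgP g0 FF).1 cvg_id x.
exact: (metricType_numDomainType.cvgrPdist_lt _ _).1 h _ e0.
Qed.

Lemma ball_act_open (g0 : G) b : \forall g \near g0, ball_act g b = ball_act g0 b.
Proof.
have [x [l [Ll bE]]] := ball_setP b.
have := near_isometry g0 x (L_pos Ll); apply: filterS => g gl.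
apply: ballset_eq; rewrite /= bE !closed_ball_at_image.
by apply: closed_ball_at_eq; rewrite metric_sym ltW.
Qed.

Lemma compact_isometries_bounded (Q : set G) (x : U) : L !=set0 -> compact Q ->
  exists2 l, L l & forall g, Q g -> mdist x (g x) <= l.
Proof.
move=> [l0 Ll0] /compact_near_coveringP Qc.
(* Along the upper tails of [L], a bound valid near each isometry of [Q] becomes a common bound by
   compactness. Near [g] the bound is local because the ultrametric inequality does not increase
   it. *)
pose F := filter_from L (fun l => [set l' | L l' /\ l <= l']).
have FF : Filter F.
  apply: filter_from_filter; first by exists l0.
  move=> l l' Ll Ll'; exists (Num.max l l').
    by rewrite /Num.max; case: ifP.
  by move=> d [Ld]; rewrite ge_max => /andP[].
have [|l Ll lQ] := Qc R F (fun l g => mdist x (g x) <= l) FF.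
  move=> g Qg; have [l Ll gl] : exists2 l, L l & mdist x (g x) <= l.
    have [<-|/eqP xg] := eqVneq x (g x).
      by exists l0 => //; rewrite mdistxx ltW// L_pos.
    by exists (mdist x (g x)) => //; exact: (urysohn_dist UU).
  exists ([set g' | mdist (g x) ((g' : G) x) < l], [set l' | L l' /\ l <= l']).
    by split; [exact: near_isometry (L_pos Ll)|exists l].
  move=> [g' l'] /= [g'l [Ll' ll']].
  rewrite (le_trans (urysohn_ultra UU _ (g x) _))// ge_max.
  by rewrite (le_trans gl)//= (le_trans (ltW g'l)).
by exists l => //; apply: lQ.
Qed.

Lemma isometry_group_not_T : L !=set0 ->
  (forall l, L l -> exists2 l', L l' & l < l') -> ~ property_T R G.
Proof.
move=> L0 Lunb; apply: (permutation_not_T ball_act1 ball_actM ball_act_open).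
  move=> b; have [x [l [Ll bE]]] := ball_setP b.
  (* Centers at a mutual distance larger than the radius give pairwise distinct balls, all in one
     orbit by transitivity. *)
  have [l' Ll' ll'] := Lunb _ Ll.
  have [z [zx zl']] := urysohn_spread L_pos UU x Ll'.
  have [g gz] := choice (fun n => isometry_transitive L_pos UU x (z n)).
  exists g => i j /(congr1 ball_set); rewrite /= bE !closed_ball_at_image !gz.
  move=> ij; have [//|nij] := eqVneq i j.
  have : closed_ball_at (z i) l (z j).
    by rewrite ij /closed_ball_at/= mdistxx ltW// L_pos.
  by rewrite /closed_ball_at/= zl'// leNgt ll'.
move=> Q Qc; have [l0 Ll0] := L0.
have [x0 _] : exists x0 : U, True.
  by have [_ _ _ UL _] := UU; move: Ll0; rewrite -UL => -[_ [x _]]; exists x.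
(* Each [g] in [Q] moves [x0] by at most [l], so [g x0] is another center of the same ball and the
   ball is preserved. *)
have [l Ll lQ] := compact_isometries_bounded x0 L0 Qc.
have bP : exists x l', L l' /\ closed_ball_at x0 l = closed_ball_at x l'.
  by exists x0, l.
exists (Ballset bP) => g /lQ gl; apply: ballset_eq.
by rewrite /= closed_ball_at_image -(closed_ball_at_eq gl).
Qed.

End balls.

Theorem proposition8p2 (R : realType) (Lambda : set R)
    (Lambda_pos : Lambda `<=` [set x | 0 < x])
    (Lambda_neq0 : Lambda !=set0) (Lambda_countable : countable Lambda)
    (U : metricType R) (U_urysohn : ultrametric_urysohn Lambda U) :
  property_T R (isometry_group U) <->
  exists2 m, Lambda m & forall x, Lambda x -> x <= m.
Proof.
split=> [UT|[m Lm m_max]]; last first.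
  exact: isometry_group_property_T Lambda_pos U_urysohn Lm m_max.
apply: contrapT => nomax; apply: (isometry_group_not_T Lambda_pos U_urysohn) UT => // l Ll.
apply: contrapT => lmax; apply: nomax; exists l => // x Lx.
by rewrite leNgt; apply/negP => lx; apply: lmax; exists x.
Qed.
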